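(* Let $\mathscr{A}'$ be a free arrangement in $V\cong\mathbb{K}^\ell$ ($\mathbb{K}=\mathbb{R}$ or $\mathbb{C}$), let $\mathscr{B}$ be an arrangement in $V$ disjoint from $\mathscr{A}'$ with an ordered partition $\pi=(\pi_1|\cdots|\pi_n)$, put $\mathscr{A}_k:=\mathscr{A}'\cup\bigcup_{i=1}^k\pi_i$ for $0\le k\le n$, and suppose that the addition of $\pi_{k+1}$ to $\mathscr{A}_k$ is an MAT-step for every $0\le k\le n-1$. Let $\mathscr{A}=\mathscr{A}'\cup\mathscr{B}$, with exponents $\exp(\mathscr{A})=(e_1\le\dots\le e_\ell)$, and put $\pi_{n+1}=\varnothing$. Then for each $1\le k\le n$ and each $|\pi_{k+1}|\le q\le|\pi_k|$ there is a subset $\mathscr{C}\subseteq\pi_k$ with $|\mathscr{C}|=q$ such that for $X:=\bigcap_{H\in\mathscr{C}}H$ the restriction $\mathscr{A}^X$ is free with exponents $\exp(\mathscr{A}^X)=(e_1\le\dots\le e_{\ell-q})$. Furthermore, there is a basis $\theta_1,\dots,\theta_\ell$ of $D(\mathscr{A})$ such that $\theta_1^X,\dots,\theta_{\ell-q}^X$ is a basis of $D(\mathscr{A}^X)$.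
   Context: An arrangement is a finite set $\mathscr{A}$ of linear hyperplanes of $V$. For $X$ an intersection of members of $\mathscr{A}$ (empty intersection $=V$), $\mathscr{A}^X=\{H\cap X\mid H\in\mathscr{A},H\not\supseteq X\}$ is the restriction, an arrangement in $X$. Let $S=\mathrm{Sym}(V^* )\cong\mathbb{K}[x_1,\dots,x_\ell]$, $H=\ker\alpha_H$. $D(\mathscr{A})=\{\theta\in\mathrm{Der}_{\mathbb{K}}(S)\mid\theta(\alpha_H)\in\alpha_HS\ \forall H\in\mathscr{A}\}$. $\theta=\sum f_i\,\partial/\partial x_i$ is homogeneous of degree $p$ if all $f_i$ are homogeneous of degree $p$ (or zero). $\mathscr{A}$ is free if $D(\mathscr{A})$ is a free $S$-module; its exponents are the degrees of a homogeneous basis. Let $P_X\subset S$ be the ideal generated by the $\alpha_H$ with $H\in\mathscr{A}$, $H\supseteq X$; then $S/P_X$ is the coordinate ring of $X$ and each $\theta\in D(\mathscr{A})$ induces its restriction $\theta^X\in D(\mathscr{A}^X)$, $\theta^X(f+P_X)=\theta(f)+P_X$. MAT-step: Let $\mathscr{D}$ be a free arrangement in $V$ whose largest exponent is $e$, and let $H_1,\dots,H_s\notin\mathscr{D}$ be distinct hyperplanes. The addition of $\{H_1,\dots,H_s\}$ to $\mathscr{D}$ is an MAT-step if (1) $H_1\cap\dots\cap H_s$ has codimension $s$; (2) $H_1\cap\dots\cap H_s\not\subseteq\bigcup_{H\in\mathscr{D}}H$; (3) $|\mathscr{D}|-|\{H\cap H_j\mid H\in\mathscr{D}\}|=e$ for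 $1\le j\le s$. By the Multiple Addition Theorem (Abe–Barakat–Cuntz–Hoge–Terao), $\mathscr{D}\cup\{H_1,\dots,H_s\}$ is then free, $s$ is at most the multiplicity of $e$ in $\exp(\mathscr{D})$, and the exponents of the new arrangement are obtained by replacing $s$ copies of $e$ by $e+1$. In particular all $\mathscr{A}_k$ in the claim are free. *)

(* Defs.v *)
From HB Require Import structures.
From mathcomp Require Import all_boot all_order all_algebra.
From mathcomp Require Import finmap boolp classical_sets reals.
From mathcomp Require Import complex ring_quotient mpoly.

Set Implicit Arguments.
Unset Strict Implicit.
Unset Printing Implicit Defensive.

Import GRing.Theory.

Local Open Scope ring_scope.
Local Open Scope quotient_scope.

Variant real_or_complex : fieldType -> Prop :=
  | RealField_case (R : realType) : real_or_complex R
  | ComplexField_case (R : realType) : real_or_complex (complex R).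

Section Arrangements.
Context (K : fieldType) (l : nat).

Local Notation V := 'rV[K]_l.
Local Notation S := {mpoly K[l]}.
Local Notation form := 'Hom(V, K^o).

(* The embedding of V^* in S = Sym(V^* ). *)
Definition lform (a : form) : S := \sum_i (a (delta_mx 0 i) : K) *: 'X_i.

Definition arrangement (A : {fset {vspace V}}) : Prop :=
  forall H, H \in A -> (\dim H).+1 = l.

Definition restriction (A : {fset {vspace V}}) (X : {vspace V}) :
    {fset {vspace V}} :=
  [fset (H :&: X)%VS | H in A & ~~ (X <= H)%VS]%fset.

(* The ideal P_X generated by the linear forms alpha whose kernel is a member
   of A containing X. The form alpha_H is determined by H up to a nonzero
   scalar only; here and in [logder] every choice is considered. *)
Definition P_mem (A : {fset {vspace V}}) (X : {vspace V}) : S -> bool :=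
  fun p => `[< exists s : seq (S * form),
    (forall x, x \in s -> lker x.2 \in A /\ (X <= lker x.2)%VS) /\
    p = \sum_(x <- s) x.1 * lform x.2 >].

Lemma lform_at0 a : (lform a).@[fun=> 0] = 0.
Proof.
rewrite /lform raddf_sum big1 // => i _ /=.
by rewrite mevalZ mevalXU mulr0.
Qed.

Lemma P_idealr A X : idealr_closed (P_mem A X : {pred S}).
Proof.
split.
- by apply/asboolP; exists [::]; split => //; rewrite big_nil.
- apply/negP => /asboolP[s [_]] /(congr1 (meval (fun=> 0))).
  rewrite meval1 raddf_sum big1 => [|x _] /=; last by rewrite mevalM lform_at0 mulr0.
  by move/eqP; rewrite oner_eq0.
- move=> g p q /asboolP[s [sA ->]] /asboolP[t [tA ->]]; apply/asboolP.
  exists ([seq (g * x.1, x.2) | x <- s] ++ t); split.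
    move=> x; rewrite mem_cat => /orP[/mapP[y ys ->]|]; last exact: tA.
    by have := sA _ ys.
  rewrite big_cat big_map mulr_sumr /=; congr (_ + _).
  by apply: eq_bigr => x _; rewrite mulrA.
Qed.

HB.instance Definition _ A X := isIdealr.Build S (P_mem A X) (P_idealr A X).

Definition P_ideal (A : {fset {vspace V}}) (X : {vspace V}) : idealr S := P_mem A X.

Definition coord_ring (A : {fset {vspace V}}) (X : {vspace V}) : comNzRingType :=
  {ideal_quot (P_ideal A X)}.

Definition coord_proj (A : {fset {vspace V}}) (X : {vspace V}) :
    {rmorphism S -> coord_ring A X} :=
  \pi_{ideal_quot (P_ideal A X)}%qT.

(* Logarithmic derivations of an arrangement B in a subspace X, for a
   coordinate ring R of X presented as a quotient pi : S -> R. It is used for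
   X = V with R = S and pi the identity, and for X an intersection of
   hyperplanes with R = S / P_X. The linear forms on X are the restrictions of
   the linear forms on V; the one given by alpha has kernel
   lker alpha :&: X and its class in R is pi (lform alpha). *)
Section LogDer.
Context (R : comNzRingType) (pi : {rmorphism S -> R}).

Definition derivation (th : R -> R) : Prop :=
  [/\ {morph th : f g / f + g},
      forall (c : K) f, th (pi c%:MP * f) = pi c%:MP * th f
    & forall f g, th (f * g) = th f * g + f * th g].

Context (X : {vspace V}) (B : {fset {vspace V}}).

Definition logder (th : R -> R) : Prop :=
  derivation th /\
  forall a : form, (lker a :&: X)%VS \in B ->
    exists g, th (pi (lform a)) = pi (lform a) * g.

Definition der_basis (r : nat) (th : 'I_r -> R -> R) : Prop :=
  (forall i, logder (th i)) /\
  forall et, logder et ->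
    exists! c : {ffun 'I_r -> R}, forall f, et f = \sum_i c i * th i f.

(* R is noetherian, so the module of logarithmic derivations is finitely
   generated and only finite bases have to be considered. *)
Definition der_free : Prop := exists r (th : 'I_r -> R -> R), der_basis th.

(* When R = S, th 'X_i is the coefficient of d/dx_i in th. In general the
   pi 'X_i span the linear forms on X. *)
Definition homogeneous (p : nat) (th : R -> R) : Prop :=
  forall i : 'I_l, exists2 f : S, f \is p.-homog & th (pi 'X_i) = pi f.

(* The degrees of a homogeneous basis in increasing order; [::] if there is
   no such basis. *)
Definition exponents : seq nat :=
  xget [::] (fun e : seq nat => sorted leq e /\
    exists th : 'I_(size e) -> R -> R,
      der_basis th /\ forall i : 'I_(size e), homogeneous (nth 0%N e i) (th i)).

End LogDer.

Definition D_basis (A : {fset {vspace V}}) r (th : 'I_r -> S -> S) : Prop :=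
  der_basis idfun fullv A th.
Definition D_free (A : {fset {vspace V}}) : Prop := der_free idfun fullv A.
Definition D_exp (A : {fset {vspace V}}) : seq nat := exponents idfun fullv A.

Definition DX_basis (A : {fset {vspace V}}) (X : {vspace V}) r
    (th : 'I_r -> coord_ring A X -> coord_ring A X) : Prop :=
  der_basis (coord_proj A X) X (restriction A X) th.
Definition DX_free (A : {fset {vspace V}}) (X : {vspace V}) : Prop :=
  der_free (coord_proj A X) X (restriction A X).
Definition DX_exp (A : {fset {vspace V}}) (X : {vspace V}) : seq nat :=
  exponents (coord_proj A X) X (restriction A X).

(* theta^X; see [restr_derE] for the independence of representatives. *)
Definition restr_der (A : {fset {vspace V}}) (X : {vspace V}) (th : S -> S) :
    coord_ring A X -> coord_ring A X :=
  fun f => coord_proj A X (th (repr (f : {ideal_quot (P_ideal A X)}))).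

Lemma restr_derE A X th : logder idfun fullv A th ->
  forall f, restr_der (A := A) (X := X) th (coord_proj A X f)
            = coord_proj A X (th f).
Proof.
move=> [[thD _ thM] thA] f; rewrite /restr_der /coord_proj /=.
set f' := repr _.
have th0 : th 0 = 0 by apply: (addrI (th 0)); rewrite -thD !addr0.
have thB x y : th (x - y) = th x - th y.
  by apply: (addIr (th y)); rewrite -thD !subrK.
have : f' = f %[mod {ideal_quot (P_ideal A X)}] by rewrite reprK.
move/eqP; rewrite -Quotient.idealrBE => /asboolP[s [sA Es]].
apply/eqP; rewrite -Quotient.idealrBE -thB Es; clear Es.
elim: s sA => [|x s IHs] sA; first by rewrite big_nil th0 rpred0.
have [xA Xx] := sA x (mem_head _ _).
rewrite big_cons thD thM rpredD //; last first.
  by apply: IHs => y ys; apply: sA; rewrite inE ys orbT.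
have [|g /= ->] := thA x.2; first by rewrite capvf.
apply/asboolP; exists [:: (th x.1 + x.1 * g, x.2)]; split.
  by move=> y; rewrite inE => /eqP ->.
by rewrite big_seq1 /= mulrDl -!mulrA [g * _]mulrC.
Qed.

(* Condition 3 uses truncated subtraction, but the second cardinal never
   exceeds the first. *)
Definition mat_step (D Hs : {fset {vspace V}}) : Prop :=
  [/\ D_free D,
      arrangement Hs /\ [disjoint Hs & D]%fset,
      (\dim (\bigcap_(H <- Hs) H)%VS + #|` Hs| = l)%N,
      ~ (forall v, v \in (\bigcap_(H <- Hs) H)%VS ->
           exists2 H : {vspace V}, H \in D & v \in H)
    & forall Hj, Hj \in Hs ->
        (#|` D| - #|` [fset (H :&: Hj)%VS | H in D]%fset|
         = \max_(e <- D_exp D) e)%N].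

(* The blocks are p 1, ..., p n. *)
Definition ordered_partition (n : nat) (p : nat -> {fset {vspace V}})
    (B : {fset {vspace V}}) : Prop :=
  [/\ forall i, (1 <= i <= n)%N -> p i != fset0,
      forall i j, (1 <= i < j)%N -> (j <= n)%N -> [disjoint p i & p j]%fset
    & B = (\bigcup_(i <- iota 1 n) p i)%fset].

Definition add_blocks (A : {fset {vspace V}}) (p : nat -> {fset {vspace V}})
    (k : nat) : {fset {vspace V}} :=
  (A `|` \bigcup_(i <- iota 1 k) p i)%fset.

End Arrangements.

(* Main.v *)
From HB Require Import structures.
Require Import Defs.
From mathcomp Require Import all_boot all_order all_algebra.
From mathcomp Require Import fingroup perm finmap mpoly.
From mathcomp Require Import boolp classical_sets generic_quotient ring_quotient.
From mathcomp Require Import ring zify.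

(** A MAT-step from D to D + {H_1, ..., H_t}, with largest exponent e, provides
a homogeneous basis of D(D) in which all but t members are tangent to every
H_j, while the remaining ones psi_1, ..., psi_t have degree e and psi_i is
tangent to H_j exactly when i <> j; multiplying psi_j by alpha_j gives a basis
for the enlarged arrangement. The constants governing this come from Terao's
polynomial B: theta(alpha_j) restricted to H_j is divisible by a polynomial of
degree |D| - |D^{H_j}| = e, hence is a scalar multiple of it when theta has
degree e and zero below.

For X the intersection of q of the H_j, a determinantal form of Terao's
divisibility gives Q(D)|_X | Q(D^X) det(psi_i(alpha_j)|_X), and Saito's
criterion then shows that the basis members tangent to X restrict to a basis
of D(A_k^X). No counting on X is needed.

The next step replaces the alpha_j psi_j by t linear combinations, all but
u = |pi_{k+1}| of which stay logarithmic. The q >= u hyperplanes of C are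
chosen to contain the u pivots, so that the l - q surviving members agree on X
with the previous ones up to terms alpha_j psi_j with H_j in C, which vanish
there. Later steps only change members of larger degree. Thus a basis of
D(A_k^X) consists of restrictions of elements of D(A), which lie in D(A^X),
and D(A^X) = D(A_k^X). *)

Set Implicit Arguments.
Unset Strict Implicit.
Unset Printing Implicit Defensive.

Import Order.TTheory GRing.Theory.

Local Open Scope ring_scope.

(** * Divisibility by linear forms *)

(** Condition (2) of a MAT-step is what makes the constants independent. At a point x common to all
    H_j and lying on no member of D, the Saito matrix is invertible, so the values of the basis at
    the alpha_j, taken at x, form a matrix of rank t; its j-th column is the column of constants of
    H_j times a nonzero scalar. Gaussian elimination on the constants then yields the psi_i. The
    same x shows that det(psi_i(alpha_j)|_X) is not zero, so that it can be cancelled.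

    The pairing of hyperplanes with basis members comes from one step, the pivots that must lie in C
    come from the following one; hence C is read off from two consecutive steps, an empty block
    closing the chain.

    Derivations are handled as coefficient rows, and X through linear coordinates, so that its
    coordinate ring becomes a polynomial ring; the quotient S / P_X is identified with it at the
    end. The divisors that matter are products of linear forms, and for these vanishing on a
    hyperplane takes the place of unique factorization. *)

Definition mdvd (R : comNzRingType) (p q : R) : Prop := exists h, q = p * h.

Section Divisibility.
Context (R : comNzRingType).
Implicit Types p q r : R.

Lemma mdvd0 p : mdvd p 0. Proof. by exists 0; rewrite mulr0. Qed.
Lemma mdvd1 p : mdvd 1 p. Proof. by exists p; rewrite mul1r. Qed.
Lemma mdvd_refl p : mdvd p p. Proof. by exists 1; rewrite mulr1. Qed.
Lemma mdvd_mull p q r : mdvd p q -> mdvd p (r * q).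
Proof. by move=> [h ->]; exists (r * h); rewrite mulrCA. Qed.
Lemma mdvd_mulr p q r : mdvd p q -> mdvd p (q * r).
Proof. by rewrite mulrC; apply: mdvd_mull. Qed.
Lemma mdvd_trans q p r : mdvd p q -> mdvd q r -> mdvd p r.
Proof. by move=> pq [h ->]; apply: mdvd_mulr. Qed.
Lemma mdvd_add p q r : mdvd p q -> mdvd p r -> mdvd p (q + r).
Proof. by move=> [h ->] [k ->]; exists (h + k); rewrite mulrDr. Qed.
Lemma mdvd_sum (I : Type) (s : seq I) (P : pred I) p (F : I -> R) :
  (forall i, P i -> mdvd p (F i)) -> mdvd p (\sum_(i <- s | P i) F i).
Proof.
by move=> h; elim/big_ind: _ => //; [apply: mdvd0 | move=> *; apply: mdvd_add].
Qed.
Lemma mdvd_mul p q p' q' : mdvd p q -> mdvd p' q' -> mdvd (p * p') (q * q').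
Proof. by move=> [h ->] [k ->]; exists (h * k); rewrite mulrACA. Qed.
Lemma mdvd_prod (I : eqType) (s : seq I) (P : pred I) (F G : I -> R) :
  (forall i, i \in s -> P i -> mdvd (F i) (G i)) ->
  mdvd (\prod_(i <- s | P i) F i) (\prod_(i <- s | P i) G i).
Proof.
move=> h; rewrite big_seq_cond [in X in mdvd _ X]big_seq_cond.
elim/big_ind2: _ => [|*|i /andP[]]; [exact: mdvd_refl|exact: mdvd_mul|exact: h].
Qed.
Lemma mdvd_morph (R' : comNzRingType) (f : {rmorphism R -> R'}) p q :
  mdvd p q -> mdvd (f p) (f q).
Proof. by move=> [h ->]; exists (f h); rewrite rmorphM. Qed.

End Divisibility.

(** * Restriction of polynomials to linear subspaces *)

Section Restriction.
Context (K : fieldType).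

Definition lf (m : nat) (c : 'cV[K]_m) : {mpoly K[m]} :=
  \sum_i c i 0 *: 'X_i.

Definition cst (n q m : nat) (A : 'M[K]_(n, q)) : 'M[{mpoly K[m]}]_(n, q) :=
  map_mx (@mpolyC m K) A.

(* Pull-back along y |-> y *m M: the row space of M gets coordinates y. *)
Definition res (m l : nat) (M : 'M[K]_(m, l)) : {mpoly K[l]} -> {mpoly K[m]} :=
  mmap (@mpolyC m K) (fun i => lf (col i M)).

HB.instance Definition _ m l (M : 'M[K]_(m, l)) :=
  GRing.RMorphism.copy (res M) (mmap (@mpolyC m K) (fun i => lf (col i M))).

Definition evl (m : nat) (y : 'rV[K]_m) : {mpoly K[m]} -> K :=
  meval (fun i => y 0 i).

HB.instance Definition _ m (y : 'rV[K]_m) :=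
  GRing.RMorphism.copy (evl y) (meval (fun i => y 0 i)).

Lemma lfD m (a b : 'cV[K]_m) : lf (a + b) = lf a + lf b.
Proof. by rewrite -big_split; apply: eq_bigr => i _; rewrite mxE scalerDl. Qed.

Lemma lfZ m k (a : 'cV[K]_m) : lf (k *: a) = k *: lf a.
Proof. by rewrite scaler_sumr; apply: eq_bigr => i _; rewrite mxE scalerA. Qed.

Lemma lf0 m : lf (0 : 'cV[K]_m) = 0.
Proof. by rewrite /lf big1 // => i _; rewrite mxE scale0r. Qed.

Lemma lf_sum m I (s : seq I) (F : I -> 'cV[K]_m) :
  lf (\sum_(i <- s) F i) = \sum_(i <- s) lf (F i).
Proof. exact: (big_morph _ (@lfD m) (@lf0 m)). Qed.

Lemma mcoeff_lf m (a : 'cV[K]_m) i : (lf a)@_U_(i) = a i 0.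
Proof.
rewrite /lf raddf_sum (bigD1 i) //= big1 => [|j ji]; last first.
  by rewrite mcoeffZ mcoeffXU (negPf ji) mulr0.
by rewrite mcoeffZ mcoeffXU eqxx mulr1 addr0.
Qed.

Lemma lf_inj m : injective (@lf m).
Proof. by move=> a b ab; apply/colP => i; rewrite -!mcoeff_lf ab. Qed.

Lemma lf_eq0 m (a : 'cV[K]_m) : (lf a == 0) = (a == 0).
Proof. by rewrite -(inj_eq (@lf_inj m)) lf0. Qed.

Lemma lf_homog m (a : 'cV[K]_m) : lf a \is 1.-homog.
Proof.
by apply: rpred_sum => i _; apply: rpredZ; rewrite dhomogX /= mdeg1.
Qed.

Lemma lf_delta m (i : 'I_m) : lf (delta_mx i 0) = 'X_i.
Proof.
rewrite /lf (bigD1 i) //= big1 ?mxE ?eqxx ?scale1r ?addr0 // => j ji.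
by rewrite mxE (negPf ji) scale0r.
Qed.

Lemma evl_lf m (y : 'rV[K]_m) a : evl y (lf a) = (y *m a) 0 0.
Proof.
rewrite /lf /evl raddf_sum mxE; apply: eq_bigr => i _ /=.
by rewrite mevalZ mevalXU mulrC.
Qed.

Lemma resX m l (M : 'M[K]_(m, l)) i : res M 'X_i = lf (col i M).
Proof. by rewrite /res mmapX mmap1U. Qed.

Lemma resC m l (M : 'M[K]_(m, l)) c : res M c%:MP = c%:MP.
Proof. by rewrite /res mmapC. Qed.

Lemma resZ m l (M : 'M[K]_(m, l)) c p : res M (c *: p) = c *: res M p.
Proof. by rewrite -!mul_mpolyC rmorphM /= resC. Qed.

Lemma res_lf m l (M : 'M[K]_(m, l)) a : res M (lf a) = lf (M *m a).
Proof.
rewrite {1}/lf rmorph_sum /=.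
have -> : M *m a = \sum_i a i 0 *: col i M.
  apply/colP => j; rewrite mxE summxE; apply: eq_bigr => i _.
  by rewrite !mxE mulrC.
by rewrite lf_sum; apply: eq_bigr => i _; rewrite resZ resX lfZ.
Qed.

Lemma mpoly_alg_ind m (P : {mpoly K[m]} -> Prop) :
  (forall c, P c%:MP) -> (forall i, P 'X_i) ->
  (forall p q, P p -> P q -> P (p + q)) ->
  (forall p q, P p -> P q -> P (p * q)) -> forall p, P p.
Proof.
move=> PC PX PD PM p; rewrite (mpolyE p).
apply: big_ind => [||mm _]; [exact: PC|exact: PD|].
rewrite -mul_mpolyC; apply: (PM); first exact: PC.
rewrite mpolyXE_id; apply: big_ind => [||i _]; [exact: PC|exact: PM|].
elim: (mm i) => [|k IH]; first by rewrite expr0; apply: PC.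
by rewrite exprS; apply: PM.
Qed.

Lemma res_comp m l k (M : 'M[K]_(m, l)) (N : 'M[K]_(l, k)) p :
  res M (res N p) = res (M *m N) p.
Proof.
elim/mpoly_alg_ind: p => [c|i|p q hp hq|p q hp hq].
- by rewrite !resC.
- by rewrite !resX res_lf colE colE mulmxA.
- by rewrite !rmorphD /= hp hq.
- by rewrite !rmorphM /= hp hq.
Qed.

Lemma res1 m p : res (1%:M : 'M[K]_m) p = p.
Proof.
elim/mpoly_alg_ind: p => [c|i|p q hp hq|p q hp hq].
- by rewrite !resC.
- by rewrite resX colE mul1mx lf_delta.
- by rewrite !rmorphD /= hp hq.
- by rewrite !rmorphM /= hp hq.
Qed.

Lemma evl_res m l (M : 'M[K]_(m, l)) (y : 'rV[K]_m) p :
  evl y (res M p) = evl (y *m M) p.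
Proof.
elim/mpoly_alg_ind: p => [c|i|p q hp hq|p q hp hq].
- by rewrite resC /evl !mevalC.
- by rewrite resX evl_lf colE mulmxA -colE /evl mevalXU mxE.
- by rewrite !rmorphD /= hp hq.
- by rewrite !rmorphM /= hp hq.
Qed.

Lemma res_homog m l (M : 'M[K]_(m, l)) d p :
  p \is d.-homog -> res M p \is d.-homog.
Proof.
move=> hp; rewrite (mpolyE p) rmorph_sum big_seq /=.
apply: rpred_sum => mm mp; rewrite resZ; apply: rpredZ.
rewrite -(dhomog_mf hp mp) mpolyXE_id rmorph_prod /= mdegE.
apply: (big_ind2 (fun (u : {mpoly K[m]}) k => u \is k.-homog)) => [|*|i _].
- exact: dhomog1.
- exact: dhomogM.
rewrite rmorphXn /= resX.
by have := dhomogMn (mm i) (lf_homog (col i M)); rewrite mul1n.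
Qed.

(** Substituting linear forms for the variables preserves degrees, so it acts on each homogeneous
    component separately. *)
Lemma res_pihomog m l (M : 'M[K]_(m, l)) d p :
  res M (pihomog mdeg d p) = pihomog mdeg d (res M p).
Proof.
rewrite [in RHS](pihomog_partitionE (leqnn (msize p))).
rewrite [in RHS]rmorph_sum [RHS]raddf_sum /=.
have [dp|pd] := ltnP d (msize p); last first.
  rewrite big1 => [|i _]; last first.
    have := res_homog M (pihomogP mdeg i p); apply: pihomog_ne0.
    by rewrite ltn_eqF // (leq_trans (ltn_ord i)).
  suff -> : pihomog mdeg d p = 0 by rewrite rmorph0.
  rewrite pihomogE big_seq_cond big1 // => mm /andP[mp /eqP md].
  by have := msize_mdeg_lt mp; rewrite md ltnNge pd.
rewrite (bigD1 (Ordinal dp)) //= big1 => [|i id].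
  by rewrite addr0 [RHS]pihomog_dE // res_homog // pihomogP.
have := res_homog M (pihomogP mdeg i p); apply: pihomog_ne0.
by apply: contraNneq id => e; apply/eqP/val_inj.
Qed.

(** The block matrices [row_mx U W] and [col_mx M C] are inverse to each other. The rows of [M] are
    a basis of the common kernel X of the columns of [W], and [U] reads off coordinates on X. *)
Lemma decomp_ker m l q (W : 'M[K]_(l, q)) : l = (m + q)%N -> \rank W = q ->
  exists (M : 'M[K]_(m, l)) (U : 'M[K]_(l, m)) (C : 'M[K]_(q, l)),
  [/\ U *m M + W *m C = 1%:M, M *m U = 1%:M, M *m W = 0 & C *m W = 1%:M].
Proof.
rewrite addnC => El; subst l => rW.
set L := col_ebase W; set R := row_ebase W.
have Lu : L \in unitmx by apply: col_ebase_unit.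
have Ru : R \in unitmx by apply: row_ebase_unit.
(* By full column rank, W is the left part of an invertible matrix, up to an invertible right
   factor; the other columns of that matrix give [U], and its inverse gives [M] and [C]. *)
have WE : W = lsubmx L *m R.
  rewrite -[LHS](mulmx_ebase W) -/L -/R rW.
  have -> : pid_mx q = col_mx 1%:M 0 :> 'M[K]_(q + m, q).
    exact: pid_mx_col.
  by rewrite -{1}(hsubmxK L) mul_row_col mulmx0 mulmx1 addr0.
pose N := invmx L.
have LN : L *m N = 1%:M by rewrite mulmxV.
have : N *m L = 1%:M by rewrite mulVmx.
rewrite -[N]vsubmxK -[L]hsubmxK mul_col_row scalar_mx_block.
move=> /eq_block_mx[NL1 NL2 NL3 NL4].
exists (dsubmx N), (rsubmx L), (invmx R *m usubmx N); split.
- rewrite WE mulmxA -[_ *m R *m _]mulmxA mulmxV // mulmx1 addrC -mul_row_col.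
  by rewrite hsubmxK vsubmxK -scalar_mx_block LN.
- exact: NL4.
- by rewrite WE mulmxA NL3 mul0mx.
- by rewrite WE mulmxA -[_ *m usubmx N *m _]mulmxA NL1 mulmx1 mulVmx.
Qed.

(** [U *m M] projects V onto X, so a polynomial and its pull-back along this projection agree on X;
    their difference is written in terms of the equations of X. This is how vanishing on X becomes
    membership in an ideal. *)
Lemma res_decomp m l q (M : 'M[K]_(m, l)) (U : 'M[K]_(l, m))
    (W : 'M[K]_(l, q)) (C : 'M[K]_(q, l)) : U *m M + W *m C = 1%:M ->
  forall p, exists h : 'I_q -> {mpoly K[l]},
    p = \sum_j h j * lf (col j W) + res (U *m M) p.
Proof.
move=> E p; elim/mpoly_alg_ind: p => [c|i|p q' [h hp] [k kq]|p q' [h hp] [k kq]].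
- exists (fun=> 0); rewrite resC big1 ?add0r // => j _; exact: mul0r.
- exists (fun j => (C j i)%:MP); rewrite resX -lf_delta.
  have -> : delta_mx i 0 = \sum_j C j i *: col j W + col i (U *m M).
    apply/colP => x; rewrite -[in LHS](mul1mx (delta_mx i 0)) -E mulmxDl.
    rewrite -!colE !mxE addrC summxE; congr (_ + _).
    by apply: eq_bigr => j _; rewrite !mxE mulrC.
  rewrite lfD lf_sum; congr (_ + _); apply: eq_bigr => j _.
  by rewrite lfZ mul_mpolyC.
- exists (fun j => h j + k j); rewrite rmorphD /= [in LHS]hp [in LHS]kq addrACA.
  congr (_ + _); rewrite -big_split; apply: eq_bigr => j _; exact/esym/mulrDl.
- exists (fun j => h j * q' + res (U *m M) p * k j).
  rewrite rmorphM /= [in LHS]hp mulrDl {2}kq mulrDr addrA; congr (_ + _).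
  rewrite mulr_suml mulr_sumr -big_split; apply: eq_bigr => j _ /=.
  by rewrite mulrDl mulrAC mulrA.
Qed.

Lemma mxrank_col1 m (a : 'cV[K]_m) : a != 0 -> \rank a = 1%N.
Proof. by move=> a0; rewrite -mxrank_tr rank_rV -trmx0 (inj_eq trmx_inj) a0. Qed.

(** Here the rows of [M] span ker a. Divisibility thus becomes the vanishing of a ring morphism,
    which makes primality and compatibility with gradings immediate. *)
Lemma mdvd_lfP m l (a : 'cV[K]_l) (M : 'M[K]_(m, l)) :
    l = m.+1 -> \rank M = m -> a != 0 -> M *m a = 0 -> forall p,
  res M p = 0 <-> mdvd (lf a) p.
Proof.
move=> El rM a0 Ma p; split => [|[h ->]]; last first.
  by rewrite rmorphM /= res_lf Ma lf0 mul0r.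
have ra := mxrank_col1 a0.
have [|M' [U [C [E MU M'a _]]]] := decomp_ker (m := m) _ ra; first by lia.
have MM : (M' <= M)%MS.
  have MM' : (M <= M')%MS.
    apply/submxP; exists (M *m U).
    by rewrite -[LHS]mulmx1 -E mulmxDr [M *m (a *m C)]mulmxA Ma mul0mx addr0 mulmxA.
  rewrite -(geq_leqif (mxrank_leqif_sup MM')) rM.
  by rewrite rank_leq_row.
have [h {2}->] := res_decomp E p.
move=> rp; exists (h 0); rewrite big_ord_recl big_ord0 addr0.
have -> : col 0 a = a by apply/colP => i; rewrite !mxE.
rewrite mulrC -res_comp.
have -> : res M' p = 0.
  by have [D ->] := submxP MM; rewrite -res_comp rp rmorph0.
by rewrite rmorph0 addr0.
Qed.

End Restriction.

(** Cramer's rule. The determinants on the right are again Saito determinants when f and the rows of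
    G are logarithmic. *)
Lemma mul_adj_row (R : comNzRingType) m (f : 'rV[R]_m) (G : 'M[R]_m) i :
  (f *m \adj G) 0 i =
  \det (\matrix_i' if i' == i then f else row i' G).
Proof.
rewrite (expand_det_row _ i) mxE; apply: eq_bigr => j _.
rewrite !mxE eqxx; congr (_ * _); rewrite /cofactor; congr (_ * \det _).
by apply/matrixP => u v; rewrite !mxE eq_sym (negPf (neq_lift _ _)) mxE.
Qed.

(** * Linear forms as primes, and logarithmic modules *)

Section LinearForms.
Context (K : fieldType).

(** Not symmetric: b may be zero. The transposes are there because [submx] compares row spaces,
    which makes the relation boolean. *)
Definition para (m : nat) (a b : 'cV[K]_m) : bool := (b^T <= a^T)%MS.

Lemma paraP m (a b : 'cV[K]_m) : reflect (exists k, b = k *: a) (para a b).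
Proof.
apply: (iffP sub_rVP) => [[k /(congr1 trmx)]|[k ->]].
  by rewrite linearZ /= !trmxK => ->; exists k.
by exists k; rewrite linearZ.
Qed.

Lemma para_sym m (a b : 'cV[K]_m) : b != 0 -> para a b -> para b a.
Proof.
move=> b0 /paraP[k bE]; apply/paraP; exists k^-1.
rewrite bE scalerA mulVf ?scale1r //.
by apply: contraNneq b0 => k0; rewrite bE k0 scale0r.
Qed.

Lemma para_trans m (a b c : 'cV[K]_m) : para a b -> para b c -> para a c.
Proof. by rewrite /para => ab bc; apply: submx_trans bc ab. Qed.

Lemma hyperplane_kernel m (a : 'cV[K]_m) : a != 0 ->
  exists n (M : 'M[K]_(n, m)), [/\ m = n.+1, \rank M = n, M *m a = 0 &
    forall b, M *m b = 0 -> para a b].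
Proof.
move=> a0.
have ra := mxrank_col1 a0.
case: m a a0 ra => [|n] a a0 ra; first by rewrite flatmx0 eqxx in a0.
have [|M [U [C [E MU Ma _]]]] := decomp_ker (m := n) _ ra; first by lia.
exists n, M; split => //.
  apply/eqP; rewrite eqn_leq rank_leq_row -{1}(mxrank1 K n) -MU.
  exact: mxrankM_maxl.
move=> b Mb; apply/paraP; exists ((C *m b) 0 0).
rewrite -[LHS]mul1mx -E mulmxDl -mulmxA Mb mulmx0 add0r -mulmxA.
by rewrite {1}[C *m b]mx11_scalar mul_mx_scalar.
Qed.

(** Restriction to ker a takes values in a polynomial ring, which is an integral domain. *)
Lemma lf_prime m (a : 'cV[K]_m) p q : a != 0 ->
  mdvd (lf a) (p * q) -> mdvd (lf a) p \/ mdvd (lf a) q.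
Proof.
move=> a0; have [n [M [mE rM Ma _]]] := hyperplane_kernel a0.
rewrite -!(mdvd_lfP mE rM a0 Ma) rmorphM /= => /eqP.
by rewrite mulf_eq0 => /orP[] /eqP; [left|right].
Qed.

Lemma lf_dvd_lf m (a b : 'cV[K]_m) : a != 0 ->
  mdvd (lf a) (lf b) -> para a b.
Proof.
move=> a0; have [n [M [mE rM Ma h]]] := hyperplane_kernel a0.
rewrite -(mdvd_lfP mE rM a0 Ma) res_lf => /eqP; rewrite lf_eq0 => /eqP.
exact: h.
Qed.

Lemma lf_ndvd1 m (a : 'cV[K]_m) : a != 0 -> ~ mdvd (lf a) 1.
Proof.
move=> a0; have [n [M [mE rM Ma h]]] := hyperplane_kernel a0.
by rewrite -(mdvd_lfP mE rM a0 Ma) rmorph1 => /eqP; rewrite oner_eq0.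
Qed.

Lemma lf_prime_prod m (a : 'cV[K]_m) (I : eqType) (s : seq I) (F : I -> {mpoly K[m]}) :
  a != 0 -> mdvd (lf a) (\prod_(i <- s) F i) ->
  exists2 i, i \in s & mdvd (lf a) (F i).
Proof.
move=> a0; elim: s => [|i s IH]; first by rewrite big_nil => /(lf_ndvd1 a0).
rewrite big_cons => /(lf_prime a0)[h|/IH[j js h]].
  by exists i; rewrite ?mem_head.
by exists j => //; rewrite inE js orbT.
Qed.

Lemma lf_prime_exp m (a : 'cV[K]_m) p n :
  a != 0 -> mdvd (lf a) (p ^+ n) -> mdvd (lf a) p.
Proof.
move=> a0; elim: n => [|n IH]; first by rewrite expr0 => /(lf_ndvd1 a0).
by rewrite exprS => /(lf_prime a0)[].
Qed.

Lemma lf_exp_cancel m (a : 'cV[K]_m) n p q : a != 0 -> ~ mdvd (lf a) q ->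
  mdvd (lf a ^+ n) (p * q) -> mdvd (lf a ^+ n) p.
Proof.
move=> a0 aq; elim: n p => [|n IH] p; first by move=> _; rewrite expr0; apply: mdvd1.
move=> pq; have : mdvd (lf a) (p * q).
  by apply: mdvd_trans pq; rewrite exprS; apply/mdvd_mulr/mdvd_refl.
case/(lf_prime a0) => // -[p' pE]; rewrite pE exprS.
apply: mdvd_mul; [exact: mdvd_refl|apply: IH].
move: pq => [h]; rewrite pE exprS -!mulrA => /mulfI.
by rewrite lf_eq0 => /(_ a0) ->; exists h.
Qed.

(** Encodes an arrangement: every hyperplane is listed once, by one nonzero form, so that [Qf] is
    its reduced defining polynomial. *)
Definition parr (m : nat) (s : seq 'cV[K]_m) : bool :=
  all (fun c => c != 0) s && pairwise (fun a b => ~~ para a b) s.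

Lemma parr_cons m (c : 'cV[K]_m) s : parr (c :: s) =
  [&& c != 0, all (fun b => ~~ para c b) s & parr s].
Proof. by rewrite /parr /= -!andbA; do !bool_congr. Qed.

Lemma parr_neq0 m (s : seq 'cV[K]_m) c : parr s -> c \in s -> c != 0.
Proof. by case/andP => /allP h _ /h. Qed.

Lemma parr_eq m (s : seq 'cV[K]_m) : parr s ->
  {in s &, forall a b, para a b -> a = b}.
Proof.
elim: s => [|c s IH] // /[dup] ps; rewrite parr_cons => /and3P[c0 /allP cs ps'].
move=> a b /[!inE] /orP[/eqP->|as'] /orP[/eqP->|bs'] // ab.
- by have := cs b bs'; rewrite ab.
- by have := cs a as'; rewrite (para_sym c0 ab).
- exact: IH.
Qed.

Lemma parr_uniq m (s : seq 'cV[K]_m) : parr s -> uniq s.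
Proof.
elim: s => [|c s IH] //; rewrite parr_cons => /and3P[c0 /allP cs /IH /= ->].
rewrite andbT; apply/negP => /cs /negP[]; apply/paraP; exists 1.
by rewrite scale1r.
Qed.

Lemma parr_filter m (s : seq 'cV[K]_m) (P : pred 'cV[K]_m) :
  parr s -> parr (filter P s).
Proof.
case/andP => h1 h2; apply/andP; split; last exact: pairwise_filter.
by apply/allP => c; rewrite mem_filter => /andP[_]; move/allP: h1; apply.
Qed.

Definition Qf (m : nat) (s : seq 'cV[K]_m) : {mpoly K[m]} :=
  \prod_(c <- s) lf c.

Lemma Qf_neq0 m (s : seq 'cV[K]_m) : parr s -> Qf s != 0.
Proof.
by move=> ps; rewrite prodf_seq_neq0; apply/allP => c /(parr_neq0 ps); rewrite lf_eq0.
Qed.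

Lemma Qf_homog m (s : seq 'cV[K]_m) : Qf s \is (size s).-homog.
Proof.
elim: s => [|c s IH]; first by rewrite /Qf big_nil dhomog1.
by rewrite /Qf big_cons -[size _]/(1 + size s)%N; apply: dhomogM; rewrite ?lf_homog.
Qed.

(** Powers of non-proportional forms are coprime. The extra factor [lf c] fits Terao's argument,
    where [n c] counts the hyperplanes with trace c and each class is divisible only after one copy
    of [lf c] is supplied. *)
Lemma Qf_exp_dvd m (s : seq 'cV[K]_m) (n : 'cV[K]_m -> nat) D : parr s ->
  (forall c, c \in s -> mdvd (lf c ^+ n c) (lf c * D)) ->
  mdvd (\prod_(c <- s) lf c ^+ n c) (Qf s * D).
Proof.
rewrite /Qf; elim: s => [|c s IH]; first by rewrite !big_nil => *; apply: mdvd1.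
move=> /[dup] ps; rewrite parr_cons => /and3P[c0 /allP cs ps'] h.
have [|k kE] := IH ps'.
  by move=> b bs; apply: h; rewrite inE bs orbT.
have hc := h c (mem_head _ _).
rewrite !big_cons -mulrA kE mulrCA; rewrite [X in mdvd X _]mulrC.
apply: mdvd_mul; first exact: mdvd_refl.
apply: (@lf_exp_cancel _ _ _ _ (\prod_(j <- s) lf j ^+ n j) c0).
  move=> /(lf_prime_prod c0)[b bs] /(lf_prime_exp c0) /(lf_dvd_lf c0) cb.
  by have := cs b bs; rewrite cb.
rewrite -mulrA [k * _]mulrC -kE mulrCA; exact: mdvd_mull.
Qed.

Lemma Qf_dvd m (s : seq 'cV[K]_m) p : parr s ->
  (forall c, c \in s -> mdvd (lf c) p) -> mdvd (Qf s) p.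
Proof.
(* With all exponents equal to 2, the previous lemma states the claim multiplied by [Qf s], which is
   then cancelled. *)
move=> ps h; have := @Qf_exp_dvd _ s (fun=> 2%N) p ps.
have -> : \prod_(c <- s) lf c ^+ 2 = Qf s * Qf s.
  by rewrite -big_split; apply: eq_bigr => c _; rewrite expr2.
case=> [c cs|k]; first by rewrite expr2; apply: mdvd_mul; [exact: mdvd_refl|exact: h].
rewrite -mulrA => /mulfI; rewrite Qf_neq0 // => /(_ isT) ->.
by exists k.
Qed.

(* A hyperplane is represented by a column c, with linear form [lf c], and a
   derivation by the row g of its coefficients, so that [(g *m cst m c) 0 0] is
   the value of the derivation at [lf c]. *)
Definition logv (m : nat) (s : seq 'cV[K]_m) (g : 'rV[{mpoly K[m]}]_m) : Prop :=
  forall c, c \in s -> mdvd (lf c) ((g *m cst m c) 0 0).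

(** The predicate P is a parameter so that the same notion serves [logv] and, on a subspace, [rlog].
    The number n of members is left open because freeness alone does not announce it; see
    [isbasis_size]. *)
Definition isbasis (m n k : nat) (P : 'rV[{mpoly K[m]}]_k -> Prop)
    (G : 'M[{mpoly K[m]}]_(n, k)) : Prop :=
  (forall i, P (row i G)) /\ forall f, P f -> exists! c : 'rV_n, f = c *m G.

Lemma cstM k m n q (A : 'M[K]_(m, n)) (B : 'M[K]_(n, q)) :
  cst k (A *m B) = cst k A *m cst k B.
Proof. exact: map_mxM. Qed.

Lemma cst1 k m : cst k (1%:M : 'M[K]_m) = 1%:M.
Proof. exact: map_mx1. Qed.

Lemma res_cst m l n q (M : 'M[K]_(m, l)) (A : 'M[K]_(n, q)) :
  map_mx (res M) (cst l A) = cst m A.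
Proof. by apply/matrixP => i j; rewrite !mxE resC. Qed.

Lemma evl_cst m n q (x : 'rV[K]_m) (A : 'M[K]_(n, q)) :
  map_mx (evl x) (cst m A) = A.
Proof. by apply/matrixP => i j; rewrite !mxE /evl mevalC. Qed.

(** Multiplying by the adjugate turns A v into det A times v, and some entry of v is an invertible
    constant. *)
Lemma det_dvd k n (A : 'M[{mpoly K[k]}]_n) (v : 'cV[K]_n) p : v != 0 ->
  (forall i, mdvd p ((A *m cst k v) i 0)) -> mdvd p (\det A).
Proof.
move=> v0 h; have [i vi] : exists i, v i 0 != 0.
  apply/existsP; apply: contraNT v0; rewrite negb_exists => /forallP v0.
  by apply/eqP/colP => i; rewrite mxE; apply/eqP; have := v0 i; rewrite negbK.
have /(congr1 (fun M : 'M_(_, _) => M i 0)) :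
    \adj A *m (A *m cst k v) = \det A *: cst k v.
  by rewrite mulmxA mul_adj_mx mul_scalar_mx.
rewrite !mxE => E.
have -> : \det A = (v i 0)^-1%:MP * (\det A * (v i 0)%:MP).
  by rewrite mulrCA -mpolyCM mulVf // mulr1.
apply: mdvd_mull; rewrite -E; apply: mdvd_sum => j _; exact: mdvd_mull.
Qed.

Lemma row_logv m n s (G : 'M[{mpoly K[m]}]_(n, m)) i c :
  (forall i, logv s (row i G)) -> c \in s -> mdvd (lf c) ((G *m cst m c) i 0).
Proof.
move=> h cs; have := h i c cs; rewrite -row_mul.
by rewrite [X in mdvd _ X -> _]mxE.
Qed.

Lemma saito_dvd m s (G : 'M[{mpoly K[m]}]_m) : parr s ->
  (forall i, logv s (row i G)) -> mdvd (Qf s) (\det G).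
Proof.
move=> ps h; apply: Qf_dvd => // c cs.
by apply: (det_dvd (parr_neq0 ps cs)) => i; apply: row_logv cs.
Qed.

Lemma logv_mul m n s (c : 'rV_n) (G : 'M[{mpoly K[m]}]_(n, m)) :
  (forall i, logv s (row i G)) -> logv s (c *m G).
Proof.
move=> h a as'; rewrite -mulmxA mxE; apply: mdvd_sum => j _.
by apply: mdvd_mull; apply: row_logv as'.
Qed.

(** Sufficiency in Saito's criterion: by Cramer the coefficients of f are Saito determinants divided
    by det G, and [saito_dvd] makes these quotients polynomials. *)
Lemma saito_basis m s (G : 'M[{mpoly K[m]}]_m) k : parr s -> k != 0 ->
  (forall i, logv s (row i G)) -> \det G = k *: Qf s -> isbasis (logv s) G.
Proof.
move=> ps k0 h detG; split => // f hf.
have d0 : \det G != 0 by rewrite detG scaler_eq0 negb_or k0 Qf_neq0.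
have ex i : mdvd (Qf s) ((f *m \adj G) 0 i).
  rewrite mul_adj_row; apply: (saito_dvd ps) => i'; rewrite rowK.
  by case: ifP.
have [h' hh] := choice ex.
exists (\row_i (k^-1 *: h' i)); split => [|c cE].
  apply/rowP => j; apply: (mulfI d0).
  have : f *m \adj G *m G = \det G *: f.
    by rewrite -mulmxA mul_adj_mx mul_mx_scalar.
  move/rowP/(_ j); rewrite [RHS]mxE => <-.
  rewrite !mxE mulr_sumr; apply: eq_bigr => i _.
  rewrite hh !mxE detG mulrA; congr (_ * _).
  by rewrite -scalerAr -scalerAl scalerA mulVf // scale1r.
apply/rowP => j; apply: (mulfI d0).
have : f *m \adj G = \det G *: c by rewrite cE -mulmxA mul_mx_adj mul_mx_scalar.
move/rowP/(_ j); rewrite [RHS]mxE => <-.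
by rewrite hh mxE detG -scalerAr -scalerAl scalerA mulVf // scale1r.
Qed.

Lemma mulmx_scalar_le (R : idomainType) n m (q : R) (A : 'M[R]_(n, m)) (B : 'M_(m, n)) :
  q != 0 -> A *m B = q%:M -> (n <= m)%N.
Proof.
move=> q0 /(congr1 (map_mx (@tofrac R))); rewrite map_mxM map_scalar_mx /=.
move=> E; have : \rank ((tofrac q)%:M : 'M_n) = n.
  by rewrite mxrank_unit // unitmxE det_scalar unitfE expf_neq0 // tofrac_eq0.
rewrite -E => <-; exact: leq_trans (mxrankM_maxr _ _) (rank_leq_row _).
Qed.

Lemma logv_Q m (s : seq 'cV[K]_m) (f : 'rV_m) : logv s (Qf s *: f).
Proof.
move=> c cs; rewrite -scalemxAl mxE; apply: mdvd_mulr.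
by rewrite /Qf (big_rem c cs); apply/mdvd_mulr/mdvd_refl.
Qed.

Lemma isbasis_row_mul m n (P : 'rV[{mpoly K[m]}]_m -> Prop) G k (A : 'M_(k, m)) :
  isbasis P (G : 'M_(n, m)) -> (forall i, P (row i A)) -> exists C, A = C *m G.
Proof.
move=> [_ h] hA; have [c cE] := choice (fun i => h _ (hA i)).
exists (\matrix_i c i); apply/row_matrixP => i.
by rewrite row_mul rowK; have [] := cE i.
Qed.

Lemma isbasis_free m n k (P : 'rV[{mpoly K[m]}]_k -> Prop) (G : 'M_(n, k))
    q (A B : 'M_(q, n)) : isbasis P G ->
  (forall c : 'rV_n, P (c *m G)) -> A *m G = B *m G -> A = B.
Proof.
move=> [_ h] hP E; apply/row_matrixP => i.
have [c [_ cU]] := h _ (hP (row i A)).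
have /(congr1 (row i)) := E; rewrite !row_mul => E'.
by rewrite -(cU (row i A)) // -(cU (row i B)) // -E'.
Qed.

(** The logarithmic module lies between Q S^m and S^m, so its rank is m. *)
Lemma isbasis_size m n s (G : 'M[{mpoly K[m]}]_(n, m)) :
  parr s -> isbasis (logv s) G -> n = m.
Proof.
move=> ps bG; have q0 := Qf_neq0 ps.
have hP c : logv s (c *m G) by apply: logv_mul; case: bG.
have [|C CE] := isbasis_row_mul (A := (Qf s)%:M) bG.
  move=> i; have -> : row i (Qf s)%:M = Qf s *: row i 1%:M.
    by apply/rowP => j; rewrite !mxE mulr_natr.
  exact: logv_Q.
apply/eqP; rewrite eqn_leq; apply/andP; split; last first.
  exact: (mulmx_scalar_le q0 (esym CE)).
apply: (mulmx_scalar_le q0 (A := G) (B := C)).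
apply: (isbasis_free bG) => //.
by rewrite -mulmxA -CE mul_mx_scalar mul_scalar_mx.
Qed.

End LinearForms.

(** * Saito's criterion and restrictions *)

Lemma prod_seq_const (R : comNzRingType) (I : Type) (s : seq I) (x : R) :
  \prod_(i <- s) x = x ^+ size s.
Proof.
by elim: s => [|i s IH]; rewrite ?big_nil ?expr0 // big_cons IH exprS.
Qed.

Lemma scale_mxE (R : pzRingType) m n (a : R) (A : 'M_(m, n)) i j :
  (a *: A) i j = a * A i j.
Proof. by rewrite mxE. Qed.

Lemma map_mx_entry (aT rT : Type) (f : aT -> rT) m n (A : 'M_(m, n)) i j :
  map_mx f A i j = f (A i j).
Proof. by rewrite mxE. Qed.

Section SaitoTerao.
Context (K : fieldType).

Lemma mpoly_mul_eq1 m (p q : {mpoly K[m]}) :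
  p * q = 1 -> exists2 k, k != 0 & p = k%:MP.
Proof.
rewrite mulrC => /mpoly_intro_unit /andP[/eqP pE]; rewrite unitfE => k0.
by exists (p@_0%MM).
Qed.

Lemma mdvd_antisym m (p q : {mpoly K[m]}) : p != 0 -> mdvd p q -> mdvd q p ->
  exists2 k, k != 0 & q = k *: p.
Proof.
move=> p0 [h ->] [h' E]; have [|k k0 ->] := @mpoly_mul_eq1 m h h'.
  by apply: (mulfI p0); rewrite mulr1 mulrA -E.
by exists k => //; rewrite mulrC mul_mpolyC.
Qed.

(** By primality each form divides w or its cofactor; in the second case it is cancelled, and the
    induction goes on with a shorter product. *)
Lemma mdvd_forms m (s : seq 'cV[K]_m) w :
  (forall c, c \in s -> c != 0) -> mdvd w (Qf s) ->
  (exists2 k, k != 0 & w = k%:MP) \/ exists2 c, c \in s & mdvd (lf c) w.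
Proof.
elim: s => [|c s IH] s0 [h].
  by rewrite /Qf big_nil => /esym /mpoly_mul_eq1; left.
have c0 := s0 c (mem_head _ _).
rewrite /Qf big_cons => E.
have /(lf_prime c0)[cw|[h' hE]] : mdvd (lf c) (w * h).
- by rewrite -E; apply/mdvd_mulr/mdvd_refl.
- by right; exists c; rewrite ?mem_head.
have [] := IH.
- by move=> b bs; apply: s0; rewrite inE bs orbT.
- exists h'; move: E; rewrite hE mulrCA => /mulfI; rewrite lf_eq0; exact.
- by left.
by case=> b bs bw; right; exists b; rewrite // inE bs orbT.
Qed.

Lemma Qf_exp m (s : seq 'cV[K]_m) n :
  exists2 t, {subset t <= s} & Qf s ^+ n = Qf t.
Proof.
elim: n => [|n [t ts E]]; first by exists [::]; rewrite // expr0 /Qf big_nil.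
exists (s ++ t); first by move=> c; rewrite mem_cat => /orP[|/ts].
by rewrite exprS E /Qf big_cat.
Qed.

Lemma Qf_rem m (s : seq 'cV[K]_m) c : c \in s -> Qf s = lf c * Qf (rem c s).
Proof. by move=> cs; rewrite /Qf (big_rem c cs). Qed.

(* For [c] in [s], the derivations (Qf s / lf c) v with v in ker c, together
   with (Qf s) v0 for some v0 outside ker c, are logarithmic: hence lf c
   divides the quotient of the Saito determinant by Qf s at most as often as
   Qf s / lf c does, that is, not at all. *)
Lemma saito_det m s (G : 'M[{mpoly K[m]}]_m) : parr s ->
  isbasis (logv s) G -> exists2 k, k != 0 & \det G = k *: Qf s.
Proof.
move=> ps bG; have Q0 := Qf_neq0 ps.
have [w wE] : mdvd (Qf s) (\det G) by apply: saito_dvd => //; case: bG.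
suff [k k0 wk] : exists2 k, k != 0 & w = k%:MP.
  by exists k => //; rewrite wE wk mulrC mul_mpolyC.
have dvdG (A : 'M_m) : (forall i, logv s (row i A)) -> mdvd (\det G) (\det A).
  by move=> /(isbasis_row_mul bG)[D ->]; rewrite det_mulmx; apply/mdvd_mull/mdvd_refl.
(* The multiples Q e_i of the unit vectors are logarithmic, so a nonconstant w is divisible by a
   form of [s]. *)
have : mdvd w (Qf s ^+ m).
  apply: (@mdvd_trans _ (\det G)); first by rewrite wE; apply/mdvd_mull/mdvd_refl.
  rewrite -det_scalar; apply: dvdG => i.
  have -> : row i (Qf s)%:M = Qf s *: row i 1%:M.
    by apply/rowP => j; rewrite !mxE mulr_natr.
  exact: logv_Q.
have [t ts ->] := Qf_exp s m; case/mdvd_forms => [c /ts|//|[c /ts cs cw]].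
  exact: parr_neq0.
have c0 := parr_neq0 ps cs; pose s' := rem c s.
have rc := mxrank_col1 c0.
have [n mE] : exists n, m = (n + 1)%N.
  case: m c c0 {s G ps bG Q0 w wE dvdG cw t ts cs s' rc} => [|n] c c0; last by exists n; rewrite addn1.
  by rewrite flatmx0 eqxx in c0.
subst m; have [M [U [C [E MU Mc _]]]] := decomp_ker (erefl (n + 1)%N) rc.
have uM : \det (col_mx M C) != 0.
  rewrite -unitfE; apply: (proj2 (mulmx1_unit (A := row_mx U c) _)).
  by rewrite mul_row_col.
pose A := col_mx (Qf s' *: cst (n + 1) M) (Qf s *: cst (n + 1) C).
have detA : \det A = (\det (col_mx M C))%:MP * (Qf s' ^+ n * Qf s).
  have -> : A = block_mx (Qf s')%:M 0 0 (Qf s)%:M *m cst (n + 1) (col_mx M C).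
    by rewrite /cst map_col_mx mul_block_col !mul0mx addr0 add0r !mul_scalar_mx.
  by rewrite det_mulmx det_lblock !det_scalar expr1 /cst det_map_mx mulrC.
have : mdvd w (Qf s' ^+ n).
  have [|h] := dvdG A; last first.
  - rewrite detA wE => hE; exists ((\det (col_mx M C))^-1%:MP * h).
    apply: (mulfI Q0); rewrite [RHS]mulrA [RHS]mulrCA -hE.
    rewrite [RHS]mulrA [X in _ = X * _](_ : _ = 1) ?mul1r 1?mulrC //.
    by rewrite -rmorphM /= mulfV ?rmorph1.
  - move=> i; rewrite -[i]splitK; case: (split i) => j /= d ds.
      rewrite /A rowKu linearZ /= -scalemxAl -row_mul -cstM mxE [X in _ * X]mxE.
      have [->|dc] := eqVneq d c; first by rewrite Mc !mxE mulr0; apply: mdvd0.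
      have ds' : d \in s' by rewrite /s' mem_rem_uniq ?parr_uniq // inE dc.
      by rewrite (Qf_rem ds'); apply/mdvd_mulr/mdvd_mulr/mdvd_refl.
    by rewrite /A rowKd linearZ; apply: logv_Q.
have [t' ts' ->] := Qf_exp s' n => wt.
have := mdvd_trans cw wt => /(lf_prime_prod c0)[b /ts' bs /(lf_dvd_lf c0) cb].
have bc : c = b by apply: (parr_eq ps) => //; apply: mem_rem bs.
by move: bs; rewrite -bc /s' mem_rem_uniq ?parr_uniq // inE eqxx.
Qed.


Lemma prod_partition m l (M : 'M[K]_(m, l)) (s : seq 'cV[K]_l)
    (sX : seq 'cV[K]_m) (R : comNzRingType) (F : 'cV[K]_l -> R) : parr sX ->
  (forall c, c \in s -> M *m c != 0 /\ exists2 k, k \in sX & para k (M *m c)) ->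
  \prod_(c <- s) F c = \prod_(k <- sX) \prod_(c <- s | para k (M *m c)) F c.
Proof.
move=> psX h; rewrite (exchange_big_dep xpredT) //= big_seq [RHS]big_seq.
apply: eq_bigr => c /h[Mc [k ks kc]].
rewrite big_mkcond (bigD1_seq k) ?parr_uniq //= kc big_seq_cond big1 ?mulr1 //.
move=> k' /andP[ks' /eqP k'k]; case: ifP => // k'c; case: k'k.
by apply: (parr_eq psX) => //; apply: para_trans k'c (para_sym Mc kc).
Qed.

(* For hyperplanes c of s with the same trace on the common kernel X of the
   columns of W, bordering G W with one of them gives a determinant that is
   divisible by all of them. For q = 1 this is Terao's polynomial B. *)
Lemma terao_dvd m q l (s : seq 'cV[K]_l) (M : 'M[K]_(m, l)) U
    (W : 'M[K]_(l, q)) C (G : 'M[{mpoly K[l]}]_(q, l)) (sX : seq 'cV[K]_m) :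
  U *m M + W *m C = 1%:M -> M *m W = 0 -> parr s -> parr sX ->
  (forall c, c \in s -> M *m c != 0 /\ exists2 k, k \in sX & para k (M *m c)) ->
  (forall i, logv s (row i G)) ->
  mdvd (res M (Qf s)) (Qf sX * \det (map_mx (res M) (G *m cst l W))).
Proof.
move=> E MW ps psX hs hG; set D := \det _.
pose sk k := [seq c <- s | para k (M *m c)].
have resQ k : k \in sX -> mdvd (res M (Qf (sk k))) (lf k * D).
  move=> kX; have psk : parr (sk k) by apply: parr_filter.
  case sE : (sk k) => [|x t].
    by rewrite /Qf big_nil rmorph1; apply: mdvd1.
  have : x \in sk k by rewrite sE mem_head.
  rewrite mem_filter => /andP[kx xs]; rewrite -sE.
  have [Mx _] := hs x xs; have [kx' kxE] := paraP _ _ kx.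
  have kx'0 : kx' != 0 by apply: contraNneq Mx => k0; rewrite kxE k0 scale0r.
  (* The bordering row is the Euler derivation, whose value at any linear form is that form
     itself. *)
  pose H : 'M[{mpoly K[l]}]_(1 + q, l) := col_mx (\row_i 'X_i) G.
  pose N := H *m cst l (row_mx x W).
  have dN : mdvd (Qf (sk k)) (\det N).
    apply: Qf_dvd => // c; rewrite mem_filter => /andP[kc cs].
    have [kc' kcE] := paraP _ _ kc.
    (* On X both c and x restrict to multiples of k, hence c is r x plus a combination of columns of
       W. With these coefficients [v], N v lists the values at c, all divisible by [lf c]. *)
    pose r := kc' / kx'; pose v := col_mx r%:M (C *m (c - r *: x)) : 'cV_(1 + q).
    have vE : row_mx x W *m v = c.
      have Mz : M *m (c - r *: x) = 0.
        by rewrite mulmxBr kcE -scalemxAr kxE scalerA divfK // subrr.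
      transitivity (r *: x + (c - r *: x)); last by rewrite addrC subrK.
      rewrite mul_row_col mul_mx_scalar; congr (_ + _).
      by rewrite -[RHS]mul1mx -E mulmxDl -!mulmxA Mz mulmx0 add0r.
    apply: (@det_dvd _ _ _ _ v).
      apply: contraNneq (parr_neq0 ps cs) => v0; by rewrite -vE v0 mulmx0.
    move=> i; rewrite -mulmxA -cstM vE -[i]splitK; case: (split i) => j /=.
      rewrite mul_col_mx col_mxEu; suff -> : ((\row_i 'X_i) *m cst l c) j 0 = lf c.
        exact: mdvd_refl.
      by rewrite mxE; apply: eq_bigr => u _; rewrite !mxE mulrC mul_mpolyC.
    by rewrite mul_col_mx col_mxEd; apply: row_logv cs.
  have : mdvd (res M (Qf (sk k))) (res M (\det N)) by exact: mdvd_morph.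
  suff -> : res M (\det N) = kx' *: (lf k * D).
    case=> h hE; exists (kx'^-1 *: h); rewrite -scalerAr -hE scalerA mulVf //.
    by rewrite scale1r.
  rewrite -det_map_mx /N map_mxM /= map_col_mx mul_col_mx.
  rewrite res_cst [cst m (row_mx x W)]map_row_mx !mul_mx_row.
  rewrite -/(block_mx _ _ _ _) -/(cst m x) -/(cst m W).
  have resX a : map_mx (res M) (\row_i 'X_i) *m cst m a = (lf (M *m a))%:M.
    apply/matrixP => i j; rewrite !ord1 !mxE -res_lf mulr1n rmorph_sum /=.
    by apply: eq_bigr => u _; rewrite !mxE resZ mulrC mul_mpolyC.
  (* The Euler row vanishes at the equations of X once restricted to X, which makes the matrix block
     triangular. *)
  have -> : map_mx (res M) (\row_i 'X_i) *m cst m W = 0.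
    apply/rowP => j; rewrite [RHS]mxE.
    have := resX (col j W); rewrite colE mulmxA MW mul0mx lf0 -colE.
    move/matrixP/(_ 0 0); rewrite [RHS]mxE mul0rn => <-.
    by rewrite !mxE; apply: eq_bigr => u _; rewrite !mxE.
  rewrite det_lblock resX kxE lfZ det_scalar expr1 -scalerAl.
  by rewrite /D map_mxM /= res_cst.
rewrite {1}/Qf (prod_partition _ psX hs) rmorph_prod /=.
pose n k := size (sk k).
(* On X the forms of one class are nonzero multiples of the same [lf k], so this product is Q(s)|_X
   up to a constant. *)
apply: (@mdvd_trans _ (\prod_(k <- sX) lf k ^+ n k)).
  apply: mdvd_prod => k kX _.
  rewrite rmorph_prod /= -big_filter -/(sk k) /n -prod_seq_const.
  apply: mdvd_prod => c; rewrite mem_filter => /andP[kc cs] _.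
  have [Mc _] := hs c cs; have /paraP[r rE] := para_sym Mc kc.
  by rewrite res_lf rE lfZ -mul_mpolyC; apply/mdvd_mull/mdvd_refl.
apply: Qf_exp_dvd => // k kX; apply: mdvd_trans (resQ k kX).
rewrite /Qf rmorph_prod /= /n -prod_seq_const.
apply: mdvd_prod => c; rewrite mem_filter => /andP[/paraP[r rE] cs] _.
by rewrite res_lf rE lfZ -mul_mpolyC; apply/mdvd_mull/mdvd_refl.
Qed.

(** Written in the coordinates (U | W) and restricted to X, the Saito matrix is block triangular, so
    Q(s)|_X is, up to a constant, det Z times det (Y2 W). Terao's divisibility bounds Q(s)|_X by
    Q(sX) det (Y2 W); cancelling the nonzero second factor gives det Z | Q(sX), and [saito_dvd]
    gives the converse. *)
Lemma restr_basis m q l (s : seq 'cV[K]_l) (M : 'M[K]_(m, l)) U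
    (W : 'M[K]_(l, q)) C (Y1 : 'M[{mpoly K[l]}]_(m, l))
    (Y2 : 'M[{mpoly K[l]}]_(q, l)) (sX : seq 'cV[K]_m) :
  l = (m + q)%N ->
  U *m M + W *m C = 1%:M -> M *m W = 0 -> parr s -> parr sX ->
  (forall c, c \in s -> M *m c != 0 /\ exists2 k, k \in sX & para k (M *m c)) ->
  (forall k, k \in sX -> exists2 c, c \in s & para k (M *m c)) ->
  isbasis (logv s) (col_mx Y1 Y2) ->
  map_mx (res M) (Y1 *m cst l W) = 0 ->
  \det (map_mx (res M) (Y2 *m cst l W)) != 0 ->
  isbasis (logv sX) (map_mx (res M) Y1 *m cst m U).
Proof.
move=> lE E MW ps psX hs hX bY Y1W dB; subst l.
(* Z holds the restricted derivations in coordinates of X; since their W-part vanishes on X, nothing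
   is lost. *)
set Z := _ *m _; have ZM : Z *m cst m M = map_mx (res M) Y1.
  rewrite -mulmxA -cstM -[RHS]mulmx1 -(cst1 K) -E /cst map_mxD -!/(cst _ _).
  rewrite mulmxDr [in X in _ + X]cstM [in X in _ + X]mulmxA.
  by move: Y1W; rewrite map_mxM res_cst => ->; rewrite mul0mx addr0.
have logY1 i c : c \in s -> mdvd (lf c) ((Y1 *m cst (m + q) c) i 0).
  have [h _] := bY => cs; have := h (lshift q i) c cs.
  by rewrite rowKu -row_mul mxE.
have logZ i : logv sX (row i Z).
  move=> k kX; have [c cs kc] := hX k kX.
  have [Mc _] := hs c cs; have /paraP[r ->] := para_sym Mc kc.
  rewrite lfZ -row_mul mxE -mul_mpolyC.
  have -> : cst m (r *: (M *m c)) = r%:MP *: (cst m M *m cst m c).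
    by rewrite -cstM; apply/matrixP => u v; rewrite !mxE mpolyCM.
  rewrite -scalemxAr mulmxA ZM -(res_cst M) -map_mxM.
  rewrite scale_mxE map_mx_entry; apply: mdvd_mul; first exact: mdvd_refl.
  by rewrite -res_lf; apply: mdvd_morph; apply: logY1.
have [k k0 detY] := saito_det ps bY.
set DB := \det _ in dB.
have /(congr1 (fun A => \det A)) : map_mx (res M) (col_mx Y1 Y2) *m cst m (row_mx U W)
   = block_mx Z 0 (map_mx (res M) Y2 *m cst m U) (map_mx (res M) (Y2 *m cst _ W)).
  rewrite map_col_mx {1}/cst map_row_mx -!/(cst _ _) mul_col_mx !mul_mx_row.
  by rewrite -Y1W !map_mxM /= !res_cst.
rewrite det_lblock -/DB det_mulmx !det_map_mx detY /= resZ.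
set d := \det (row_mx U W); have d0 : d != 0.
  rewrite -unitfE; apply: (proj1 (mulmx1_unit (B := col_mx M C) _)).
  by rewrite mul_row_col.
move=> dE.
have [B BE] : mdvd (res M (Qf s)) (Qf sX * DB).
  apply: (terao_dvd E) => // i; have [h _] := bY.
  by have := h (rshift m i); rewrite rowKd.
have ZQ : mdvd (\det Z) (Qf sX).
  exists (((k * d)^-1)%:MP * B); apply: (mulIf dB); rewrite BE.
  have -> : res M (Qf s) = (k * d)^-1%:MP * (\det Z * DB).
    rewrite -dE -mul_mpolyC -[LHS]mul1r mulrAC -mpolyCM mulrA -mpolyCM.
    by rewrite mulVf ?mulf_neq0 // mul1r.
  by ring.
have dZ0 : \det Z != 0.
  case: ZQ => h hE; apply: contraNneq (Qf_neq0 psX) => z0.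
  by rewrite hE z0 mul0r.
have [kk kk0 QE] := mdvd_antisym (Qf_neq0 psX) (saito_dvd psX logZ) ZQ.
exact: (saito_basis psX kk0 logZ QE).
Qed.

End SaitoTerao.

(** * Homogeneous bases *)

Section Homogeneous.
Context (K : fieldType).

Definition hrows (m n k : nat) (G : 'M[{mpoly K[k]}]_(m, n)) (d : 'I_m -> nat) : Prop :=
  forall i j, G i j \is (d i).-homog.

Lemma dhomog_msizeE m d (p : {mpoly K[m]}) :
  p != 0 -> p \is d.-homog -> msize p = d.+1.
Proof.
move=> p0 hp; rewrite (mpolySpred mdeg p0); congr _.+1.
exact: (dhomog_uniq p0 (dhomog_msize hp) hp).
Qed.

Lemma dhomog_quotient m d (p q h : {mpoly K[m]}) : p != 0 ->
  p \is d.-homog -> q \is d.-homog -> p = q * h ->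
  exists2 k, k != 0 & p = k *: q.
Proof.
move=> p0 hp hq pE; have := p0; rewrite pE mulf_eq0 negb_or => /andP[q0 h0].
have := msizeM q0 h0; rewrite -pE (dhomog_msizeE p0 hp) (dhomog_msizeE q0 hq).
rewrite addSn /= -addn1 => /eqP; rewrite eqn_add2l eq_sym => /msize_poly1P[k k0 hE].
by exists k; rewrite // pE hE mulrC mul_mpolyC.
Qed.

Lemma pihomog_mul m d e (p q : {mpoly K[m]}) : q \is d.-homog ->
  pihomog mdeg e (p * q) = if (d <= e)%N then pihomog mdeg (e - d) p * q else 0.
Proof.
move=> hq; rewrite [in LHS](pihomog_partitionE (leqnn (msize p))).
rewrite mulr_suml raddf_sum /=.
have E (b : nat) : pihomog mdeg e (pihomog mdeg b p * q) =
    if (b + d == e)%N then pihomog mdeg b p * q else 0.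
  have h := dhomogM (pihomogP mdeg b p) hq.
  by case: eqP => [<-|/eqP ne]; [rewrite pihomog_dE | rewrite (pihomog_ne0 ne)].
under eq_bigr do rewrite E.
case: leqP => [de|ed]; last first.
  by rewrite big1 // => b _; rewrite gtn_eqF // (leq_trans ed) // leq_addl.
have [lp|lp] := ltnP (e - d) (msize p).
  rewrite (bigD1 (Ordinal lp)) //= subnK // eqxx big1 ?addr0 // => b bN.
  case: eqP => // be; case/eqP: bN; apply/val_inj => /=.
  by rewrite -be addnK.
rewrite big1 => [|b _]; last first.
  case: eqP => // be; have := ltn_ord b.
  by rewrite -[X in (X < _)%N](addnK d) be ltnNge lp.
suff -> : pihomog mdeg (e - d) p = 0 by rewrite mul0r.
rewrite pihomogE big_seq_cond big1 // => mm /andP[mp /eqP md].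
by have := msize_mdeg_lt mp; rewrite md ltnNge lp.
Qed.

(** Hence the logarithmic derivations form a graded module. *)
Lemma mdvd_pihomog m (a : 'cV[K]_m) e p : a != 0 ->
  mdvd (lf a) p -> mdvd (lf a) (pihomog mdeg e p).
Proof.
move=> a0; have [n [M [mE rM Ma _]]] := hyperplane_kernel a0.
by rewrite -!(mdvd_lfP mE rM a0 Ma) res_pihomog => ->; rewrite raddf0.
Qed.

Lemma det_homog m n (G : 'M[{mpoly K[m]}]_n) d :
  hrows G d -> \det G \is (\sum_i d i)%N.-homog.
Proof.
move=> hG; apply: rpred_sum => s _; rewrite -signr_odd.
suff h : \prod_i G i (s i) \is (\sum_i d i)%N.-homog.
  by case: odd; rewrite ?expr1 ?expr0 ?mul1r // mulN1r rpredN.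
apply: (big_ind2 (fun (u : {mpoly K[m]}) k => u \is k.-homog)) => [|*|i _] //.
- exact: dhomog1.
- exact: dhomogM.
Qed.

(* Expanding the Saito determinant of an arbitrary basis multilinearly into
   homogeneous components, some term of degree |s| is a nonzero multiple of
   Qf s; its rows form a homogeneous basis. *)
Lemma homog_basis_exists m (s : seq 'cV[K]_m) (G : 'M[{mpoly K[m]}]_m) :
  parr s -> isbasis (logv s) G ->
  exists G' d, isbasis (logv s) G' /\ hrows (G' : 'M_m) d.
Proof.
move=> ps bG; have [k k0 detG] := saito_det ps bG.
(* All degrees lie below N, so that the choices of one component per row form a finite type. *)
pose N := (\max_(ij : 'I_m * 'I_m) msize (G ij.1 ij.2))%N.
pose Gf (f : {ffun 'I_m -> 'I_N}) := \matrix_(i, j) pihomog mdeg (f i) (G i j).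
have hGf f : hrows (Gf f) (fun i => f i : nat) by move=> i j; rewrite mxE pihomogP.
have GE i j : G i j = \sum_(d < N) pihomog mdeg d (G i j).
  apply: pihomog_partitionE.
  exact: (@leq_bigmax _ (fun ij : 'I_m * 'I_m => msize (G ij.1 ij.2)) (i, j)).
have detE : \det G = \sum_f \det (Gf f).
  rewrite exchange_big; apply: eq_bigr => s' _; rewrite -mulr_sumr; congr (_ * _).
  under eq_bigr => i _ do rewrite GE.
  rewrite bigA_distr_bigA; apply: eq_bigr => f _.
  by apply: eq_bigr => i _; rewrite mxE.
have [f [fs f0]] : exists f : {ffun 'I_m -> 'I_N},
    (\sum_i f i)%N = size s /\ \det (Gf f) != 0.
  apply: contrapT => nf; have : pihomog mdeg (size s) (\det G) = 0.
    rewrite detE raddf_sum big1 // => f _ /=.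
    have [fs|fs] := eqVneq (\sum_i f i)%N (size s); last first.
      exact: (pihomog_ne0 fs (det_homog (hGf f))).
    have [->|f0] := eqVneq (\det (Gf f)) 0; first exact: raddf0.
    by case: nf; exists f.
  rewrite detG linearZ /= pihomog_dE ?Qf_homog // => /eqP.
  by rewrite scaler_eq0 (negPf k0) (negPf (Qf_neq0 ps)).
exists (Gf f), (fun i => f i : nat); split => //.
have logGf i : logv s (row i (Gf f)).
  move=> c cs; have -> : (row i (Gf f) *m cst m c) 0 0
      = pihomog mdeg (f i) ((row i G *m cst m c) 0 0).
    rewrite [in RHS]mxE raddf_sum mxE; apply: eq_bigr => j _ /=.
    by rewrite !mxE [in RHS]mulrC mul_mpolyC linearZ /= mulrC mul_mpolyC.
  apply: mdvd_pihomog; first exact: parr_neq0 ps cs.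
  by case: bG => h _; apply: h.
have [h hE] := saito_dvd ps logGf.
have hd := det_homog (hGf f); rewrite fs in hd.
have [k' k'0 E] := dhomog_quotient f0 hd (Qf_homog s) hE.
exact: (saito_basis ps k'0 logGf E).
Qed.

(* The constant term of the transition matrix between two homogeneous bases is
   invertible, and its entries vanish unless the degrees agree. *)
Lemma homog_basis_degrees k n n' (P : 'rV[{mpoly K[k]}]_k -> Prop)
    (G : 'M_(n, k)) (G' : 'M_(n', k)) d d' :
  isbasis P G -> isbasis P G' -> hrows G d -> hrows G' d' ->
  (forall c : 'rV_n, P (c *m G)) -> (forall c : 'rV_n', P (c *m G')) ->
  perm_eq [seq d i | i : 'I_n] [seq d' i | i : 'I_n'].
Proof.
move=> bG bG' hG hG' PG PG'.
have [C CE] := isbasis_row_mul bG (proj1 bG').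
have [C' C'E] := isbasis_row_mul bG' (proj1 bG).
have CC' : C *m C' = 1%:M.
  by apply: (isbasis_free bG') => //; rewrite mul1mx -mulmxA -C'E.
have C'C : C' *m C = 1%:M.
  by apply: (isbasis_free bG) => //; rewrite mul1mx -mulmxA -CE.
have nn : n = n'.
  by apply/eqP; rewrite eqn_leq (mulmx_scalar_le _ C'C) ?(mulmx_scalar_le _ CC') ?oner_eq0.
subst n'; have Cd i j : (C i j)@_0%MM != 0 -> d' i = d j.
  (* The components of matching degree of the coefficients are again coefficients of row i of G', so
     uniqueness identifies them with [C]. *)
  have Ci : \row_j (if (d j <= d' i)%N then pihomog mdeg (d' i - d j) (C i j) else 0)
      = row i C.
    apply: (isbasis_free bG) => //; rewrite -row_mul -CE; apply/rowP => u.
    rewrite [RHS]mxE -[RHS](pihomog_dE (hG' i u)) CE [in RHS]mxE raddf_sum mxE.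
    apply: eq_bigr => v _ /=; rewrite mxE (pihomog_mul _ _ (hG v u)).
    by case: leqP; rewrite ?mul0r.
  have /rowP/(_ j) := Ci; rewrite !mxE => <-.
  case: leqP => [dd|_]; last by rewrite mcoeff0 eqxx.
  have [E|ne] := eqVneq (d' i - d j)%N 0%N.
    by move=> _; apply/eqP; rewrite eqn_leq dd -subn_eq0 E.
  move=> /eqP []; apply: (dhomog_nemf_coeff (pihomogP mdeg _ _)).
  by rewrite mf0 eq_sym.
pose c := map_mx (mcoeff 0%MM) C.
have c0 : \det c != 0.
  rewrite -unitfE; apply: (proj1 (mulmx1_unit (B := map_mx (mcoeff 0%MM) C') _)).
  by rewrite /c -map_mxM CC' map_mx1.
(* A nonzero determinant has a nonzero term; its permutation matches members of equal degree. *)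
have [s sc] : exists s : 'S_n, forall i, c i (s i) != 0.
  apply: contrapT => ns; case/eqP: c0; rewrite /determinant big1 // => s _.
  suff [i ci] : exists i, c i (s i) = 0.
    by rewrite (bigD1 i) //= ci mul0r mulr0.
  apply: contrapT => ni; apply: ns; exists s => i; apply/eqP => ci.
  by apply: ni; exists i.
have -> : [seq d' i | i : 'I_n] = [seq d i | i <- [seq s i | i : 'I_n]].
  by rewrite -map_comp; apply: eq_map => i /=; apply: Cd; have := sc i; rewrite mxE.
apply: perm_map; rewrite perm_sym; apply: uniq_perm.
- by rewrite map_inj_uniq ?enum_uniq //; apply: perm_inj.
- exact: enum_uniq.
move=> i; rewrite mem_enum; apply/mapP; exists ((s^-1)%g i); rewrite ?mem_enum //.
by rewrite permKV.
Qed.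

End Homogeneous.

(** * Multiple addition *)

Section MultipleAddition.
Context (K : fieldType).

(** Elimination that moves the t pivot rows to the end. [T] differs from the identity only in the
    last t columns, so a row is altered by pivot rows alone; its first r rows are those of the
    identity, which protects the members of lower degree. *)
Lemma pivot_rows l t r (A : 'M[K]_(l, t)) : \rank A = t -> (r <= l)%N ->
  (forall (i : 'I_l) j, (i < r)%N -> A i j = 0) ->
  exists (s : 'S_l) (T : 'M[K]_l),
  [/\ (r + t <= l)%N, forall i : 'I_l, (i < r)%N -> s i = i, T \in unitmx,
      forall (i : 'I_l) (j : 'I_t), (T *m row_perm s A) i j = (i == l - t + j :> nat)%N%:R
    & (forall i (k : 'I_l), (k < l - t)%N -> T i k = (i == k)%:R) /\
      (forall (i : 'I_l) k, (i < r)%N -> T i k = (i == k)%:R)].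
Proof.
move=> rA rl A0.
have fA : row_full A by rewrite /row_full rA.
pose f := fullrankfun fA.
have fu : rowsub f A \in unitmx by apply: fullrowsub_unit.
have finj : injective f by apply: fullrankfun_inj.
have fr j : (r <= f j)%N.
  rewrite leqNgt; apply/negP => fj.
  have : row j (rowsub f A) = 0 by apply/rowP => u; rewrite !mxE A0.
  move/(congr1 (mulmx^~ (invmx (rowsub f A)))); rewrite -row_mul mulmxV // mul0mx.
  by move/rowP/(_ j); rewrite !mxE eqxx => /eqP; rewrite oner_eq0.
(* The non-pivots keep their order and precede the pivots. Since no pivot lies below r, the first r
   indices stay in place. *)
pose L1 := [seq i <- enum 'I_l | i \notin codom f]; pose L := L1 ++ codom f.
have LU : uniq L.
  rewrite cat_uniq filter_uniq ?enum_uniq //= (map_inj_uniq finj) enum_uniq andbT.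
  by apply/hasPn => i fi; rewrite mem_filter fi.
have LE : perm_eq L (enum 'I_l).
  apply: uniq_perm => //; first exact: enum_uniq.
  by move=> i; rewrite mem_cat mem_filter !mem_enum andbT orbC orbN.
have sL : size L = l by rewrite (perm_size LE) size_enum_ord.
have sL1 : size L1 = (l - t)%N.
  by move: sL; rewrite size_cat size_codom card_ord; lia.
have tl : (t <= l)%N by rewrite -rA rank_leq_row.
pose L2 := take r (enum 'I_l).
have L12 : exists L3, L1 = L2 ++ L3.
  exists [seq i <- drop r (enum 'I_l) | i \notin codom f].
  rewrite /L1 -[in LHS](cat_take_drop r (enum 'I_l)) filter_cat; congr (_ ++ _).
  apply/all_filterP/allP => i /(nthP i)[k]; rewrite size_take size_enum_ord => kr <-.
  have {}kr : (k < r)%N by move: kr; case: (ltnP r l); lia.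
  rewrite nth_take //; apply/codomP => -[j fj]; have := fr j.
  by rewrite -fj nth_enum_ord; lia.
have [L3 L3E] := L12.
have sL2 : size L2 = r by rewrite size_take size_enum_ord; case: (ltnP r l); lia.
have rtl : (r + t <= l)%N by move: sL1; rewrite L3E size_cat sL2; lia.
have sinj : injective (fun i : 'I_l => nth i L i).
  move=> i j /=; rewrite (set_nth_default i) ?sL // => /eqP.
  by rewrite nth_uniq ?sL // => /eqP/val_inj.
pose s := perm sinj.
have sr (i : 'I_l) : (i < r)%N -> s i = i.
  move=> ir; rewrite permE /L L3E -catA nth_cat sL2 ir nth_take //.
  by apply/val_inj; rewrite /= nth_enum_ord.
have sf (i : 'I_l) (j : 'I_t) : i = (l - t + j)%N :> nat -> s i = f j.
  move=> ij; rewrite permE /L nth_cat sL1 ij ltnNge leq_addr /= addKn.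
  rewrite (nth_map j) ?size_enum_ord //; congr (f _).
  by apply/val_inj; rewrite /= nth_enum_ord.
exists s.
have [m mE] : exists m, l = (m + t)%N by exists (l - t)%N; rewrite subnK.
subst l; move: sf; rewrite addnK => sf.
pose B := row_perm s A; pose N := dsubmx B; pose Bu := usubmx B.
have BE : B = col_mx Bu N by rewrite vsubmxK.
have NE : N = rowsub f A.
  by apply/matrixP => i j; rewrite !mxE (sf _ i).
have Nu : N \in unitmx by rewrite NE.
have B0 (i : 'I_m) j : (i < r)%N -> Bu i j = 0.
  by move=> ir; rewrite !mxE sr ?A0.
(* N is the invertible block of pivot rows: normalise it to the identity and clear the rows above
   it. *)
exists (block_mx 1%:M (- (Bu *m invmx N)) 0 (invmx N)); split => //.
- by rewrite unitmxE det_ublock det1 mul1r -unitmxE unitmx_inv.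
- move=> i j; rewrite -/B BE mul_block_col mul1mx mul0mx add0r mulNmx.
  rewrite -mulmxA mulVmx // mulmx1 subrr mxE.
  case: splitP => i' ->; rewrite ?mxE.
    by rewrite ltn_eqF // (leq_trans (ltn_ord i')) // leq_addr.
  by rewrite eqn_add2l.
split.
- move=> i k km; rewrite mxE; case: splitP => i' iE; rewrite mxE; case: splitP => k' kE.
  + by rewrite mxE; congr (_%:R); rewrite -!(inj_eq val_inj) /= iE kE.
  + by move: km; rewrite kE; lia.
  + rewrite mxE -(inj_eq val_inj) /= iE kE gtn_eqF //.
    by rewrite (leq_trans (ltn_ord k')) // leq_addr.
  + by move: km; rewrite kE; lia.
move=> i k ir; rewrite mxE; case: splitP => i' iE; rewrite mxE; last by lia.
case: splitP => k' kE.
  by rewrite mxE; congr (_%:R); rewrite -!(inj_eq val_inj) /= iE kE.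
rewrite mxE mxE big1 ?oppr0 => [|u _]; last by rewrite B0 ?mul0r // -iE.
rewrite -(inj_eq val_inj) /= iE kE ltn_eqF //.
by rewrite (leq_trans (ltn_ord i')) // leq_addr.
Qed.

(** The label [f] stands for the trace of a hyperplane on X. A MAT-step counts traces as subspaces,
    whereas Terao's argument needs them as forms up to scalars; the size equation links both
    counts. *)
Lemma class_reps m l (M : 'M[K]_(m, l)) (T : eqType) (f : 'cV[K]_l -> T)
    (s : seq 'cV[K]_l) :
  (forall c, c \in s -> M *m c != 0) ->
  (forall c c', c \in s -> c' \in s -> f c = f c' <-> para (M *m c) (M *m c')) ->
  exists sX, [/\ parr sX,
    forall c, c \in s -> exists2 k, k \in sX & para k (M *m c),
    forall k, k \in sX -> exists2 c, c \in s & k = M *m c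
    & size sX = size (undup (map f s))].
Proof.
elim: s => [|c s IH] s0 hf; first by exists [::].
have [||sX [psX cov mem sz]] := IH.
- by move=> b bs; apply: s0; rewrite inE bs orbT.
- by move=> b b' bs bs'; apply: hf; rewrite inE ?bs ?bs' orbT.
have Mc := s0 c (mem_head _ _).
have [/mapP[b bs fb]|nf] := boolP (f c \in map f s).
  exists sX; split => //; last 1 first.
  - by rewrite /= fb map_f.
  - move=> c' /[!inE] /orP[/eqP->|]; last exact: cov.
    have [k ks kb] := cov b bs; exists k => //.
    apply: para_trans kb _; apply/hf => //; rewrite ?mem_head ?inE ?bs ?orbT //.
  - by move=> k /mem[c' cs ->]; exists c'; rewrite // inE cs orbT.
exists (M *m c :: sX); split.
- rewrite parr_cons Mc psX andbT /=; apply/allP => k /mem[b bs ->].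
  apply: contra nf => cb; apply/mapP; exists b => //.
  by apply/hf => //; rewrite ?mem_head // inE bs orbT.
- move=> c' /[!inE] /orP[/eqP->|/cov[k ks kc]].
    by exists (M *m c); rewrite ?mem_head //; apply/paraP; exists 1; rewrite scale1r.
  by exists k; rewrite // inE ks orbT.
- move=> k /[!inE] /orP[/eqP->|/mem[b bs ->]]; first by exists c; rewrite ?mem_head.
  by exists b; rewrite // inE bs orbT.
- by rewrite /= (negPf nf) /= sz.
Qed.

(* The scalars g i are the quotients of the values at [a], restricted to ker a,
   by Terao's polynomial B of degree E; z is the value of B at x. *)
Lemma mat_coeff l n (s : seq 'cV[K]_l) (G : 'M[{mpoly K[l]}]_(n, l)) d E
    (a : 'cV[K]_l) (x : 'rV[K]_l) (T : eqType) (f : 'cV[K]_l -> T) :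
  parr s -> (forall i, logv s (row i G)) -> hrows G d -> (forall i, (d i <= E)%N) ->
  a != 0 -> x *m a = 0 -> (forall c, c \in s -> x *m c != 0) ->
  (forall c c', c \in s -> c' \in s ->
     f c = f c' <-> exists k k', c' = k *: c + k' *: a) ->
  (size s - size (undup (map f s)))%N = E ->
  exists (g : 'cV[K]_n) z, [/\ z != 0,
    forall v : 'rV[K]_n, v *m g = 0 -> mdvd (lf a) ((cst l v *m G *m cst l a) 0 0),
    forall i, evl x ((G *m cst l a) i 0) = g i 0 * z
    & forall i, (d i < E)%N -> g i 0 = 0].
Proof.
move=> ps hG hd dE a0 xa xs hf sE.
have ra := mxrank_col1 a0.
have [m lE] : exists m, l = (m + 1)%N.
  have := rank_leq_row a; rewrite ra => l0; exists l.-1; by rewrite addn1 prednK.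
have [M [U [C [EM MU Ma Ca]]]] := decomp_ker lE ra.
have kerM b : M *m b = 0 -> b = (C *m b) 0 0 *: a.
  move=> Mb; rewrite -[LHS]mul1mx -EM mulmxDl -mulmxA Mb mulmx0 add0r -mulmxA.
  by rewrite {1}[C *m b]mx11_scalar mul_mx_scalar.
have [y xE] : exists y, x = y *m M.
  exists (x *m U).
  by rewrite -mulmxA -[LHS]mulmx1 -EM mulmxDr [x *m (a *m C)]mulmxA xa mul0mx addr0.
have Ms c : c \in s -> M *m c != 0.
  by move=> /xs; apply: contraNneq; rewrite xE -mulmxA => ->; rewrite mulmx0.
have [|sX [psX cov mem sz]] := class_reps (f := f) Ms.
  move=> c c' cs cs'; rewrite hf //; split => [[k [k' ->]]|/paraP[k kE]].
    by apply/paraP; exists k; rewrite mulmxDr -!scalemxAr Ma scaler0 addr0.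
  have /kerM E' : M *m (c' - k *: c) = 0 by rewrite mulmxBr -scalemxAr kE subrr.
  by exists k; rewrite -(subrK (k *: c) c') E'; eexists; rewrite addrC.
pose rho i := res M ((G *m cst l a) i 0).
have Qs0 : res M (Qf s) != 0.
  rewrite /Qf rmorph_prod /= prodf_seq_neq0; apply/allP => c cs.
  by rewrite res_lf lf_eq0 Ms.
(* Terao's polynomial is Q(s)|_X / Q(sX); clearing the denominator avoids a division. *)
have key i : exists g, Qf sX * rho i = g *: res M (Qf s) /\ ((d i < E)%N -> g = 0).
  have := terao_dvd (G := row i G) EM Ma ps psX.
  have -> : \det (map_mx (res M) (row i G *m cst l a)) = rho i.
    by rewrite det_mx11 map_mx_entry -row_mul [row i _ 0 0]mxE.
  case=> [c cs|i'|h hE]; first by split; [apply: Ms|apply: cov].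
    have -> : row i' (row i G) = row i G by apply/rowP => j; rewrite !mxE.
    exact: hG.
  have [r0|r0] := eqVneq (rho i) 0.
    by exists 0; rewrite r0 mulr0 scale0r.
  have hrho : rho i \is (d i).-homog.
    apply: res_homog; rewrite mxE; apply: rpred_sum => j _.
    by rewrite map_mx_entry mulrC mul_mpolyC; apply: rpredZ; apply: hd.
  have Q0 := Qf_neq0 psX.
  have h0 : h != 0.
    by apply: contraNneq (mulf_neq0 Q0 r0) => h0; rewrite hE h0 mulr0.
  have := congr1 (fun p => msize p) hE; rewrite /= !msizeM //.
  rewrite (dhomog_msizeE Q0 (Qf_homog _)) (dhomog_msizeE r0 hrho).
  rewrite (dhomog_msizeE Qs0 (res_homog M (Qf_homog s))) !addSn addnS /= => hs.
  have := size_undup (map f s); rewrite size_map => us.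
  have h1 : (0 < msize h)%N by rewrite lt0n msize_poly_eq0.
  (* Degree count: |sX| + d i = |s| + deg h, with |s| - |sX| = E and d i at most E, leaves only a
     constant h and d i = E. Here h' is [msize h], the degree plus one. *)
  have arith a' r e h' : (r + e).+1 = (a' + h')%N -> (a' - r)%N = E ->
    (r <= a')%N -> (e <= E)%N -> (0 < h')%N -> h' = 1%N /\ e = E by clear; lia.
  rewrite -sz in us; have [|//|//||/eqP/msize_poly1P[k k0 hk] ->] := arith _ _ _ _ hs.
  - by rewrite sz.
  - exact: h1.
  exists k; split; last by rewrite ltnn.
  by rewrite hE hk mulrC mul_mpolyC.
have [g gE] := choice key.
have Qy : evl y (Qf sX) != 0.
  rewrite /Qf rmorph_prod /= prodf_seq_neq0; apply/allP => k /mem[c cs ->].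
  rewrite evl_lf mulmxA -xE; apply: contra (xs c cs) => /eqP e0.
  by apply/eqP/rowP => j; rewrite ord1 e0 mxE.
have Qx : evl x (Qf s) != 0.
  rewrite /Qf rmorph_prod /= prodf_seq_neq0; apply/allP => c cs.
  rewrite evl_lf; apply: contra (xs c cs) => /eqP e0.
  by apply/eqP/rowP => j; rewrite ord1 e0 mxE.
have rM : \rank M = m.
  apply/eqP; rewrite eqn_leq rank_leq_row -{1}(mxrank1 K m) -MU.
  exact: mxrankM_maxl.
exists (\col_i g i), (evl x (Qf s) / evl y (Qf sX)); split.
- by rewrite mulf_neq0 ?invr_eq0.
- move=> v vg; apply/(mdvd_lfP (M := M)) => //; first by rewrite lE addn1.
  apply: (mulfI (Qf_neq0 psX)); rewrite mulr0.
  have -> : res M ((cst l v *m G *m cst l a) 0 0) = \sum_i v 0 i *: rho i.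
    rewrite -mulmxA mxE rmorph_sum; apply: eq_bigr => i _ /=.
    by rewrite mxE rmorphM /= resC mul_mpolyC.
  rewrite mulr_sumr; under eq_bigr do rewrite -scalerAr (gE _).1 scalerA.
  rewrite -scaler_suml; move/rowP/(_ 0): vg; rewrite !mxE => vg.
  suff -> : \sum_i v 0 i * g i = 0 by rewrite scale0r.
  by rewrite -[RHS]vg; apply: eq_bigr => i _; rewrite mxE.
- move=> i; apply: (mulIf Qy); rewrite -mulrA divfK //.
  have E' : evl y (Qf sX) * evl y (rho i) = g i * evl y (res M (Qf s)).
    by rewrite -rmorphM (gE i).1 -mul_mpolyC rmorphM; congr (_ * _); apply: mevalC.
  have Ex p : evl x p = evl y (res M p) by rewrite xE evl_res.
  have -> : (\col_i g i) i 0 = g i by rewrite mxE.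
  by rewrite !Ex [LHS]mulrC; apply: E'.
- by move=> i di; rewrite mxE (gE i).2.
Qed.

End MultipleAddition.

Lemma mulmx_colE (R : pzSemiRingType) m n q (A : 'M[R]_(m, n)) (B : 'M_(n, q)) j :
  A *m col j B = col j (A *m B).
Proof. by rewrite !colE mulmxA. Qed.

(** * A MAT-step on coefficient matrices *)

Section Steps.
Context (K : fieldType).

Lemma isbasis_unit m n s (T : 'M_n) (G : 'M[{mpoly K[m]}]_(n, m)) :
  T \in unitmx -> isbasis (logv s) G -> isbasis (logv s) (T *m G).
Proof.
move=> uT [hG bG]; split => [i|f /bG[c [cE cU]]].
  by rewrite row_mul; apply: logv_mul.
exists (c *m invmx T); split => [|c' c'E].
  by rewrite -mulmxA mulKmx.
by apply: (canLR (mulmxK uT)); apply: cU; rewrite -mulmxA.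
Qed.

(** Scaling the rows multiplies the Saito determinant by exactly the new forms. The set P is
    arbitrary because this is applied to a whole block and also to the part of a block outside C. *)
Lemma scale_basis l s (G : 'M[{mpoly K[l]}]_l) (aa : 'I_l -> 'cV[K]_l) (P : pred 'I_l) :
  parr s -> parr (s ++ [seq aa k | k <- enum P]) -> isbasis (logv s) G ->
  (forall i k, P k -> i != k -> mdvd (lf (aa k)) ((G *m cst l (aa k)) i 0)) ->
  isbasis (logv (s ++ [seq aa k | k <- enum P]))
    (\matrix_(i, j) ((if P i then lf (aa i) else 1) * G i j)).
Proof.
move=> ps ps' bG h; pose D : 'rV_l := \row_i (if P i then lf (aa i) else 1).
have YE : \matrix_(i, j) ((if P i then lf (aa i) else 1) * G i j) = diag_mx D *m G.
  by apply/matrixP => i j; rewrite mul_diag_mx !mxE.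
have [k k0 detG] := saito_det ps bG.
apply: (saito_basis ps' k0); last first.
  rewrite YE det_mulmx det_diag detG /Qf big_cat -scalerAr mulrC; congr (_ *: (_ * _)).
  rewrite big_map big_enum [RHS]big_mkcond; apply: eq_bigr => i _.
  by rewrite mxE.
move=> i c; rewrite mem_cat -row_mul YE -mulmxA mxE mul_diag_mx [X in mdvd _ X]mxE => /orP[cs|].
  by apply: mdvd_mull; case: bG => hG _; apply: row_logv cs.
case/mapP => u; rewrite mem_enum => Pu ->.
have [iu|ui] := eqVneq i u; last by apply: mdvd_mull; apply: h.
by apply: mdvd_mulr; rewrite mxE iu ifT //; apply: mdvd_refl.
Qed.

(** Elimination on the matrix of constants given by [mat_coeff] for each H_j. Rows whose constant at
    j is zero are tangent to H_j; the t pivot rows keep a nonzero value at x. *)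
Lemma mat_step_model l t s (G : 'M[{mpoly K[l]}]_l) d E r (W : 'M[K]_(l, t)) x
    (T : eqType) (f : 'I_t -> 'cV[K]_l -> T) :
  parr s -> isbasis (logv s) G -> hrows G d -> (r <= l)%N ->
  (forall i : 'I_l, (i < r)%N -> (d i < E)%N) ->
  (forall i : 'I_l, (r <= i)%N -> d i = E) ->
  \rank W = t -> x *m W = 0 -> (forall c, c \in s -> x *m c != 0) ->
  (forall j c c', c \in s -> c' \in s ->
     f j c = f j c' <-> exists k k', c' = k *: c + k' *: col j W) ->
  (forall j, (size s - size (undup (map (f j) s)))%N = E) ->
  exists (p : 'S_l) (T : 'M[K]_l), let G1 := cst l T *m row_perm p G in
  [/\ (r + t <= l)%N, forall i : 'I_l, (i < r)%N -> p i = i,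
      forall i (k : 'I_l), (k < l - t)%N -> T i k = (i == k)%:R,
      isbasis (logv s) G1 & hrows G1 d] /\
  (forall (i : 'I_l) (j : 'I_t), i <> (l - t + j)%N :> nat ->
     mdvd (lf (col j W)) ((G1 *m cst l W) i j)) /\
  (forall (i : 'I_l) (j : 'I_t), i = (l - t + j)%N :> nat ->
     evl x ((G1 *m cst l W) i j) != 0) /\
  (forall i : 'I_l, (i < r)%N -> row i G1 = row i G).
Proof.
move=> ps bG hd rl dlt deq rW xW xs hf sE.
have dE i : (d i <= E)%N by case: (ltnP i r) => [/dlt/ltnW|/deq->].
have W0 j : col j W != 0.
  apply/eqP => W0; have : row_free W^T by rewrite /row_free mxrank_tr rW.
  move/row_freeP => [B /(congr1 (row j))]; rewrite row_mul -tr_col W0 trmx0 mul0mx.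
  by move/rowP/(_ j); rewrite !mxE eqxx => /eqP; rewrite eq_sym oner_eq0.
have key j : exists gz : 'cV[K]_l * K, [/\ gz.2 != 0,
    forall v : 'rV[K]_l, v *m gz.1 = 0 ->
      mdvd (lf (col j W)) ((cst l v *m G *m cst l (col j W)) 0 0),
    forall i, evl x ((G *m cst l (col j W)) i 0) = gz.1 i 0 * gz.2
    & forall i, (d i < E)%N -> gz.1 i 0 = 0].
  have [h _] := bG; have xj : x *m col j W = 0.
    by rewrite colE mulmxA xW mul0mx.
  have [g [z [z0 h1 h2 h3]]] := mat_coeff ps h hd dE (W0 j) xj xs (hf j) (sE j).
  by exists (g, z).
have [gz gzP] := choice key.
pose A := \matrix_(i, j) (gz j).1 i 0.
have colA j : col j A = (gz j).1 by apply/colP => i; rewrite !mxE.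
have [k k0 detG] := saito_det ps bG.
have Qx : evl x (Qf s) != 0.
  rewrite /Qf rmorph_prod /= prodf_seq_neq0; apply/allP => c cs.
  rewrite evl_lf; apply: contra (xs c cs) => /eqP e0.
  by apply/eqP/rowP => j; rewrite ord1 e0 mxE.
have uG : map_mx (evl x) G \in unitmx.
  rewrite unitmxE unitfE det_map_mx detG -mul_mpolyC rmorphM /= {1}/evl mevalC.
  by rewrite mulf_neq0.
have colW j : cst l (col j W) = col j (cst l W) by rewrite /cst map_col.
have colE' n (B : 'M[{mpoly K[l]}]_(n, l)) i j : (B *m cst l (col j W)) i 0 = (B *m cst l W) i j.
  by rewrite colW mulmx_colE mxE.
have GWE : map_mx (evl x) (G *m cst l W) = A *m diag_mx (\row_j (gz j).2).
  apply/matrixP => i j; rewrite mul_mx_diag map_mx_entry -colE'.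
  by have [_ _ -> _] := gzP j; rewrite !mxE.
(* G(x) is invertible, so G(x) W has the rank of W; and G(x) W is A times a diagonal matrix. *)
have rA : \rank A = t.
  apply/eqP; rewrite eqn_leq rank_leq_col /=.
  rewrite -[X in (X <= _)%N]rW.
  have <- : \rank (map_mx (evl x) (G *m cst l W)) = \rank W.
    by rewrite map_mxM /= evl_cst eqmxMfull // row_full_unit.
  by rewrite GWE mxrankM_maxl.
have [|p [T' [rtl pr uT TE [T1 T2]]]] := pivot_rows rA rl.
  by move=> i j /dlt di; rewrite mxE; have [_ _ _ ->] := gzP j.
exists p, T' => G1.
have G1E : G1 = cst l (T' *m perm_mx p) *m G.
  by rewrite /G1 row_permE cstM -mulmxA /cst map_perm_mx.
have TpA i j : row i (T' *m perm_mx p) *m (gz j).1 = (i == l - t + j :> nat)%N%:R%:M.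
  rewrite -colA -row_mul mulmx_colE -mulmxA -row_permE -TE.
  by apply/rowP => u; rewrite ord1 [LHS]mxE [LHS]mxE [RHS]mxE eqxx mulr1n.
split; last split; last split.
- split => //.
    rewrite G1E; apply: isbasis_unit bG; rewrite /cst unitmxE det_map_mx.
    apply: rmorph_unit; rewrite -unitmxE unitmx_mul uT; exact: unitmx_perm.
  move=> i j; rewrite mxE; apply: rpred_sum => u _; rewrite !mxE mul_mpolyC.
  (* A nonzero entry of T' lies on the diagonal, or joins two rows of index at least r, all of
     degree E; [p] respects both ranges. *)
  have [->|Tiu] := eqVneq (T' i u) 0; first by rewrite scale0r rpred0.
  apply: rpredZ; suff <- : d (p u) = d i by apply: hd.
  have [ir|ri] := ltnP i r.
    by move: Tiu; rewrite T2 //; case: (eqVneq i u) => [<-|]; rewrite ?eqxx // pr.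
  have ru : (r <= u)%N.
    rewrite leqNgt; apply/negP => ur; move: Tiu; rewrite T1; last by lia.
    by case: (eqVneq i u) ri => [->|_]; rewrite ?eqxx // leqNgt ur.
  rewrite !deq // leqNgt; apply/negP => pur.
  by have /perm_inj E' := pr _ pur; rewrite E' ltnNge ru in pur.
- move=> i j /eqP/negPf ij; have [_ h _ _] := gzP j.
  have := h (row i (T' *m perm_mx p)); rewrite TpA ij -scalemx1 scale0r => /(_ erefl).
  by rewrite /cst map_row -/(cst _ _) -!row_mul -G1E mxE colE'.
- move=> i j ij; have [z0 _ h _] := gzP j.
  suff -> : evl x ((G1 *m cst l W) i j) = (gz j).2 by [].
  rewrite -map_mx_entry G1E -mulmxA map_mxM /= evl_cst GWE mulmxA mul_mx_diag.
  rewrite mxE -mulmxA -row_permE TE ij eqxx mul1r; exact: mxE.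
move=> i ir; apply/rowP => j; rewrite 2!mxE (bigD1 i) //= big1 => [|u ui].
  by rewrite !mxE T2 // eqxx mpolyC1 mul1r addr0 pr.
by rewrite mxE T2 // eq_sym (negPf ui) mpolyC0 mul0r.
Qed.

End Steps.

(** * Derivations of a presented coordinate ring *)

Section Presentation.
Context (K : fieldType) (l m : nat).

Definition ev (c : 'cV[K]_l) (v : 'rV[K]_l) : K^o := (v *m c) 0 0.

Lemma ev_is_linear c : linear (ev c).
Proof. by move=> k u v; rewrite /ev mulmxDl -scalemxAl !mxE. Qed.

HB.instance Definition _ c :=
  GRing.isLinear.Build K 'rV[K]_l K^o *:%R (ev c) (ev_is_linear c).

Definition hp (c : 'cV[K]_l) : {vspace 'rV[K]_l} := lker (linfun (ev c)).

Lemma mem_hp c v : (v \in hp c) = (v *m c == 0).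
Proof.
rewrite memv_ker lfunE /= /ev; apply/eqP/eqP => [h|->]; last by rewrite mxE.
by apply/rowP => i; rewrite ord1 h mxE.
Qed.

Definition colf (a : 'Hom('rV[K]_l, K^o)) : 'cV[K]_l :=
  \col_i (a (delta_mx 0 i) : K).

Lemma colfE (a : 'Hom('rV[K]_l, K^o)) v : a v = (v *m colf a) 0 0.
Proof.
rewrite {1}(row_sum_delta v) linear_sum mxE; apply: eq_bigr => i _.
by rewrite linearZ mxE.
Qed.

Lemma lker_colf a : lker a = hp (colf a).
Proof.
apply/vspaceP => v; rewrite memv_ker mem_hp colfE; apply/eqP/eqP => [h|->].
  by apply/rowP => i; rewrite ord1 h mxE.
by rewrite mxE.
Qed.

Lemma lform_colf a : lform a = lf (colf a).
Proof. by apply: eq_bigr => i _; rewrite mxE. Qed.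

Lemma colf_ev c : colf (linfun (ev c)) = c.
Proof.
apply/colP => i; rewrite mxE lfunE /= /ev -rowE; by rewrite mxE.
Qed.

(* A quotient R of S presented through an isomorphism phi with the polynomial
   ring in m variables, S -> R being restriction to the row space of M. *)
Context (M : 'M[K]_(m, l)) (U : 'M[K]_(l, m)) (MU : M *m U = 1%:M).
Context (R : comNzRingType) (phi : {rmorphism {mpoly K[m]} -> R}).
Context (psi : R -> {mpoly K[m]}) (phiK : cancel phi psi) (psiK : cancel psi phi).
Context (pi : {rmorphism {mpoly K[l]} -> R}) (piE : forall p, pi p = phi (res M p)).
Context (X : {vspace 'rV[K]_l}) (B : {fset {vspace 'rV[K]_l}}).

(** Transcribes [logder] to coefficient rows, with the condition imposed for every form c whose
    trace belongs to B and not just for one form per hyperplane. *)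
Definition rlog (g : 'rV[{mpoly K[m]}]_m) : Prop :=
  forall c, (hp c :&: X)%VS \in B -> mdvd (lf (M *m c)) ((g *m cst m (M *m c)) 0 0).

Definition vec (th : R -> R) : 'rV[{mpoly K[m]}]_m := \row_j psi (th (phi 'X_j)).

Definition der (g : 'rV[{mpoly K[m]}]_m) (r : R) : R :=
  phi (\sum_j g 0 j * (psi r)^`M(j)).

Lemma psiD : {morph psi : x y / x + y}.
Proof. by move=> x y; rewrite -{1}[x]psiK -{1}[y]psiK -rmorphD phiK. Qed.

Lemma psiM : {morph psi : x y / x * y}.
Proof. by move=> x y; rewrite -{1}[x]psiK -{1}[y]psiK -rmorphM phiK. Qed.

Lemma pi_res q : phi q = pi (res U q).
Proof. by rewrite piE res_comp MU res1. Qed.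

Lemma mderiv_lf b j : (lf b)^`M(j) = (b j 0)%:MP :> {mpoly K[m]}.
Proof.
rewrite /lf linear_sum (bigD1 j) //= big1 => [|i ij].
  rewrite addr0 mderivZ mderivX mnmE eqxx scale1r -mul_mpolyC.
  suff -> : 'X_[U_(j) - U_(j)] = 1 :> {mpoly K[m]} by rewrite mulr1.
  rewrite -mpolyX0; congr 'X_[_]; apply/mnmP => u; by rewrite !mnmE subnn.
by rewrite mderivZ mderivX mnmE (negPf ij) scale0r scaler0.
Qed.

Lemma mderiv_XU i j : ('X_i)^`M(j) = (i == j)%:R :> {mpoly K[m]}.
Proof. by rewrite -lf_delta mderiv_lf mxE andbT eq_sym; case: eqP. Qed.

Lemma derivation_vec th : derivation pi th -> forall q,
  th (phi q) = phi (\sum_j vec th 0 j * q^`M(j)).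
Proof.
move=> [thD thZ thM]; have th1 : th 1 = 0.
  by apply: (addrI (th 1)); rewrite addr0 -{3}[1]mulr1 thM mulr1 mul1r.
have piC c : pi c%:MP = phi c%:MP by rewrite piE resC.
elim/mpoly_alg_ind => [c|i|p q hp hq|p q hp hq].
- rewrite -piC -[pi _]mulr1 thZ th1 mulr0 big1 ?rmorph0 // => j _.
  by rewrite mderivC mulr0.
- rewrite (bigD1 i) //= big1 => [|j ji].
    by rewrite addr0 mderiv_XU eqxx mulr1 mxE psiK.
  by rewrite mderiv_XU eq_sym (negPf ji) mulr0.
- rewrite rmorphD thD hp hq -rmorphD -big_split; congr (phi _).
  by apply: eq_bigr => j _; rewrite mderivD mulrDr.
- rewrite rmorphM thM hp hq -!rmorphM -rmorphD mulr_suml mulr_sumr -big_split.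
  congr (phi _); apply: eq_bigr => j _ /=; rewrite mderivM; ring.
Qed.

Lemma derivation_lf th b : derivation pi th ->
  th (phi (lf b)) = phi ((vec th *m cst m b) 0 0).
Proof.
move=> /derivation_vec ->; congr (phi _); rewrite mxE; apply: eq_bigr => j _.
by rewrite mderiv_lf [in RHS]mxE [in RHS]map_mx_entry mxE.
Qed.

Lemma der_derivation g : derivation pi (der g).
Proof.
split=> [x y|c f|x y].
- rewrite /der -rmorphD -big_split; congr (phi _); apply: eq_bigr => j _.
  by rewrite psiD mderivD mulrDr.
- rewrite /der piE resC -rmorphM mulr_sumr; congr (phi _); apply: eq_bigr => j _.
  by rewrite psiM phiK mderiv_mulC mulrCA.
- rewrite /der -[in RHS](psiK x) -[in RHS](psiK y) !phiK -!rmorphM -rmorphD.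
  rewrite mulr_suml mulr_sumr -big_split; congr (phi _); apply: eq_bigr => j _ /=.
  by rewrite psiM mderivM; ring.
Qed.

Lemma vec_der g : vec (der g) = g.
Proof.
apply/rowP => j; rewrite mxE /der phiK phiK (bigD1 j) //= big1 => [|i ij].
  by rewrite addr0 mderiv_XU eqxx mulr1.
by rewrite mderiv_XU eq_sym (negPf ij) mulr0.
Qed.

Lemma logderP th : derivation pi th ->
  (logder pi X B th <-> rlog (vec th)).
Proof.
move=> dth; split => [[_ h] c cB|h].
  have [|g] := h (linfun (ev c)); first by rewrite lker_colf colf_ev.
  rewrite lform_colf colf_ev piE res_lf derivation_lf // => E.
  by exists (psi g); rewrite -[LHS]phiK E psiM phiK.
split => // a; rewrite lker_colf => /h[g gE]; exists (phi g).
by rewrite lform_colf piE res_lf derivation_lf // gE rmorphM.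
Qed.

Lemma vec_sum n (c : 'I_n -> R) (ths : 'I_n -> R -> R) th :
  derivation pi th -> (forall i, derivation pi (ths i)) ->
  ((forall f, th f = \sum_i c i * ths i f) <->
   vec th = (\row_i psi (c i)) *m \matrix_i vec (ths i)).
Proof.
move=> dth dths; split => [h|E f].
  apply/rowP => j; rewrite !mxE h (big_morph psi psiD (_ : psi 0 = 0)); last first.
    by rewrite -(rmorph0 phi) phiK.
  by apply: eq_bigr => i _; rewrite psiM !mxE.
rewrite -(psiK f) derivation_vec // E.
under [RHS]eq_bigr => i _ do rewrite derivation_vec // -[c i]psiK -rmorphM.
rewrite -rmorph_sum; congr (phi _).
under [RHS]eq_bigr do rewrite mulr_sumr; rewrite exchange_big.
apply: eq_bigr => j _; rewrite mxE mulr_suml; apply: eq_bigr => i _.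
by rewrite !mxE mulrA.
Qed.

Lemma der_basisP n (ths : 'I_n -> R -> R) :
  (forall i, derivation pi (ths i)) ->
  (der_basis pi X B ths <-> isbasis rlog (\matrix_i vec (ths i))).
Proof.
move=> dths; split => [[h1 h2]|[h1 h2]]; split.
- move=> i; rewrite rowK; apply/logderP => //; exact: h1.
- move=> f fl; have df := der_derivation f.
  have [|c [cE cU]] := h2 (der f); first by apply/logderP; rewrite ?vec_der.
  exists (\row_i psi (c i)); split.
    by rewrite -[LHS]vec_der; apply/(vec_sum _ df dths).
  move=> c' c'E; apply/rowP => i; rewrite mxE.
  have -> : c = [ffun i => phi (c' 0 i)].
    apply: cU; apply/(vec_sum _ df dths); rewrite vec_der [LHS]c'E.
    by congr (_ *m _); apply/rowP => j; rewrite mxE ffunE phiK.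
  by rewrite ffunE phiK.
- by move=> i; apply/logderP => //; have := h1 i; rewrite rowK.
- move=> et [det]; move=> h; have /h2[c [cE cU]] : rlog (vec et) by apply/logderP.
  exists [ffun i => phi (c 0 i)]; split.
    apply/(vec_sum _ det dths); rewrite cE.
    by congr (_ *m _); apply/rowP => j; rewrite mxE ffunE phiK.
  move=> c' c'E; apply/ffunP => i; rewrite ffunE.
  have -> : c = \row_i psi (c' i) by apply: cU; apply/(vec_sum _ det dths).
  by rewrite mxE psiK.
Qed.

(** The images of the 'X_i only span the linear forms on X. Coordinates on X are recovered from them
    through [U], and [res U] provides homogeneous lifts in the other direction. *)
Lemma homogeneousP d th : derivation pi th ->
  (homogeneous pi d th <-> forall j, vec th 0 j \is d.-homog).
Proof.
move=> dth; split => [h j|h i].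
  have /choice[f fP] i : exists f, f \is d.-homog /\ th (pi 'X_i) = pi f.
    by have [f] := h i; exists f.
  have -> : vec th 0 j = \sum_i U i j *: res M (f i).
    have -> : vec th 0 j = \sum_i U i j *: (vec th *m cst m (col i M)) 0 0.
      transitivity ((vec th *m cst m (M *m U)) 0 j).
        by rewrite MU /cst map_mx1 mulmx1.
      rewrite cstM mulmxA mxE; apply: eq_bigr => i _.
      rewrite mulrC [in LHS]map_mx_entry mul_mpolyC; congr (_ *: _).
      by rewrite /cst map_col mulmx_colE [in RHS]mxE.
    apply: eq_bigr => i _; congr (_ *: _); apply: (can_inj phiK).
    by rewrite -derivation_lf // -resX -!piE; have [] := fP i.
  apply: rpred_sum => i _; apply: rpredZ; apply: res_homog; by have [] := fP i.
have -> : pi 'X_i = phi (lf (col i M)) by rewrite piE resX.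
rewrite derivation_lf // pi_res; eexists; last reflexivity.
apply: res_homog; rewrite mxE; apply: rpred_sum => j _.
by rewrite map_mx_entry mulrC mul_mpolyC; apply: rpredZ; apply: h.
Qed.

Lemma rlog_mul n (G : 'M_(n, m)) (c : 'rV_n) :
  (forall i, rlog (row i G)) -> rlog (c *m G).
Proof.
move=> h a aB; rewrite -mulmxA mxE; apply: mdvd_sum => j _; apply: mdvd_mull.
by have [q qE] := h j a aB; exists q; rewrite -qE -row_mul [RHS]mxE.
Qed.

(** [exponents] is a choice among sorted degree lists, so its value is known only once the list is
    unique; this is [homog_basis_degrees]. *)
Lemma exponents_basis n (G : 'M_(n, m)) d : isbasis rlog G -> hrows G d ->
  exponents pi X B = sort leq [seq d i | i : 'I_n].
Proof.
move=> bG hG; set e := sort _ _.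
have PG c : rlog (c *m G) by apply: rlog_mul; case: bG.
have se : size e = n by rewrite size_sort size_map size_enum_ord.
have sortede : sorted leq e by apply: sort_sorted; apply: leq_total.
apply: xget_unique.
  split => //; pose si := sort (relpre d leq) (enum 'I_n).
  have eE : e = map d si by rewrite /e sort_map.
  have sis : size si = n by rewrite size_sort size_enum_ord.
  have isU : uniq si by rewrite sort_uniq enum_uniq.
  pose w (i : 'I_(size e)) : 'I_n := cast_ord se i.
  (* [q] enumerates the members by increasing degree, [w i] being the default of [nth]. *)
  pose q i : 'I_n := nth (w i) si i.
  exists (fun i => der (row (q i) G)).
  have wn (i : 'I_(size e)) : (i < n)%N := ltn_ord (w i).
  have nthe (k : nat) (i0 : 'I_n) : (k < n)%N -> nth 0%N e k = d (nth i0 si k).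
    by move=> kn; rewrite eE (nth_map i0) ?sis.
  have qd i : hrows (row (q i) G) (fun=> nth 0%N e i).
    have -> : nth 0%N e i = d (q i).
      by rewrite (nthe _ (w i) (wn i)).
    by move=> i' j; rewrite mxE.
  split; last first.
    move=> i; apply/homogeneousP; first exact: der_derivation.
    by move=> j; rewrite vec_der; apply: qd.
  apply/der_basisP => [i|]; first exact: der_derivation.
  have -> : \matrix_i vec (der (row (q i) G)) = \matrix_i row (q i) G.
    by apply/row_matrixP => i; rewrite !rowK vec_der.
  have qinj : injective q.
    move=> i j; rewrite /q (set_nth_default (w j)) ?sis ?wn // => /eqP.
    by rewrite nth_uniq ?sis ?wn // => /eqP/val_inj.
  have [q' qK q'K] : bijective q by apply: inj_card_bij; rewrite ?card_ord ?se.
  case: bG => hlog bG; split => [i|f /bG[c [cE cU]]]; first by rewrite rowK.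
  exists (\row_i c 0 (q i)); split.
    rewrite cE; apply/rowP => j; rewrite !mxE (reindex q) /=; last by exists q' => x _.
    by apply: eq_bigr => i _; rewrite !mxE.
  move=> c' c'E; rewrite (cU (\row_i c' 0 (q' i))).
    by apply/rowP => i; rewrite !mxE qK.
  rewrite c'E; apply/rowP => j; rewrite !mxE [RHS](reindex q) /=; last by exists q' => x _.
  by apply: eq_bigr => i _; rewrite !mxE qK.
move=> e' [se' [th [bth hth]]].
apply: (sorted_eq leq_trans anti_leq) => //.
rewrite perm_sym perm_sort perm_sym.
have dth i : derivation pi (th i) by have [/(_ i)[]] := bth.
have bG' := (der_basisP dth).1 bth.
have hG' : hrows (\matrix_i vec (th i)) (fun i => nth 0%N e' i).
  move=> i j; rewrite mxE; exact: (proj1 (homogeneousP _ (dth i)) (hth i)).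
have PG' c : rlog (c *m \matrix_i vec (th i)) by apply: rlog_mul; case: bG'.
have := homog_basis_degrees bG bG' hG hG' PG PG'.
rewrite [X in perm_eq _ X -> _](_ : _ = e'); first by rewrite perm_sym.
transitivity (map (nth 0%N e') (map val (enum 'I_(size e')))).
  by rewrite -map_comp.
by rewrite val_enum_ord map_nth_iota0 // take_size.
Qed.

End Presentation.

(** * Arrangements of subspaces *)

Section Hyperplanes.
Context (K : fieldType) (l : nat).

Lemma dim_hp (c : 'cV[K]_l) : c != 0 -> (\dim (hp c)).+1 = l.
Proof.
move=> c0; have := limg_ker_dim (linfun (ev c)) fullv.
rewrite capfv -/(hp c) dimvf /dim /= mul1n => E.
rewrite -[RHS]E -addn1; congr (_ + _)%N.
apply/eqP; rewrite eqn_leq; apply/andP; split; last first.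
  by apply: leq_trans (dimvS (subvf _)) _; rewrite dimvf.
rewrite lt0n dimv_eq0; apply: contra c0 => /eqP h.
apply/eqP/colP => i; rewrite mxE -[c in LHS]colf_ev mxE.
by have := memv_img (linfun (ev c)) (memvf (delta_mx 0 i)); rewrite h memv0 => /eqP.
Qed.

Lemma hp_exists (H : {vspace 'rV[K]_l}) : (\dim H).+1 = l ->
  exists c, c != 0 /\ hp c = H.
Proof.
move=> dH; pose A := \matrix_i (vbasis H)`_i : 'M[K]_(\dim H, l).
have : kermx A^T != 0.
  rewrite -mxrank_eq0 mxrank_ker mxrank_tr -lt0n subn_gt0 -[X in (_ < X)%N]dH ltnS.
  exact: rank_leq_row.
case/rowV0Pn => u /sub_kermxP uA u0; exists u^T.
have u0' : u^T != 0 by rewrite -trmx0 (inj_eq trmx_inj).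
split => //; apply/eqP; rewrite eq_sym eqEdim; apply/andP; split; last first.
  by rewrite -ltnS dim_hp // dH.
rewrite -(span_basis (vbasisP H)); apply/span_subvP => v /(nthP 0)[i].
rewrite size_tuple => id <-; rewrite mem_hp.
have := congr1 (fun B => row (Ordinal id) B^T) uA.
by rewrite trmx_mul trmxK row_mul rowK trmx0 row0 => ->.
Qed.

(** A fixed choice of alpha_H; the value is 0 exactly when H is not a hyperplane. *)
Definition cof (H : {vspace 'rV[K]_l}) : 'cV[K]_l :=
  xget 0 [set c | c != 0 /\ hp c = H]%classic.

Lemma cofP H : (\dim H).+1 = l -> cof H != 0 /\ hp (cof H) = H.
Proof. by move=> /hp_exists[c hc]; rewrite /cof; case: xgetP => [? -> //|/(_ c)]. Qed.

Lemma sub_hpE m (M : 'M[K]_(m, l)) (X : {vspace 'rV[K]_l}) c :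
  (forall v, (v \in X) = (v <= M)%MS) -> (X <= hp c)%VS = (M *m c == 0).
Proof.
move=> XM; apply/subvP/eqP => [h|Mc v]; last first.
  by rewrite XM mem_hp => /submxP[y ->]; rewrite -mulmxA Mc mulmx0.
apply/row_matrixP => i; rewrite row_mul row0.
by apply/eqP; rewrite -mem_hp; apply: h; rewrite XM row_sub.
Qed.

Lemma hp_capE m (M : 'M[K]_(m, l)) (X : {vspace 'rV[K]_l}) c c' :
  (forall v, (v \in X) = (v <= M)%MS) -> M *m c != 0 -> M *m c' != 0 ->
  (hp c :&: X = hp c' :&: X)%VS <-> para (M *m c) (M *m c').
Proof.
move=> XM Mc Mc'.
have memE a y : (y *m M \in (hp a :&: X)%VS) = (y *m (M *m a) == 0).
  by rewrite memv_cap mem_hp XM submxMl andbT mulmxA.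
split => [E|/paraP[k kE]].
  have [n [N [_ _ Nc h]]] := hyperplane_kernel Mc; apply: h.
  apply/row_matrixP => i; rewrite row_mul row0; apply/eqP.
  by rewrite -memE -E memE -row_mul Nc row0.
have k0 : k != 0 by apply: contraNneq Mc' => k0; rewrite kE k0 scale0r.
apply/vspaceP => v; have [/submxP[y ->]|vM] := boolP (v <= M)%MS.
  by rewrite !memE kE -scalemxAr scaler_eq0 (negPf k0).
by rewrite !memv_cap !XM (negPf vM) !andbF.
Qed.

Lemma hp_eqE (c c' : 'cV[K]_l) : c != 0 -> c' != 0 -> hp c = hp c' <-> para c c'.
Proof.
move=> c0 c'0; have h (v : 'rV[K]_l) : (v \in fullv) = (v <= (1%:M : 'M[K]_l))%MS.
  by rewrite memvf submx1.
by rewrite -{2}[c]mul1mx -{2}[c']mul1mx -(hp_capE h) ?mul1mx // !capvf.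
Qed.

Definition cols (A : seq {vspace 'rV[K]_l}) : seq 'cV[K]_l := map cof A.

Lemma parr_cols A : uniq A -> (forall H, H \in A -> (\dim H).+1 = l) -> parr (cols A).
Proof.
elim: A => [|H A IH] // /andP[HA uA] dA; rewrite [cols _]/= parr_cons.
have dH : (\dim H).+1 = l by apply: dA; rewrite mem_head.
have [c0 hc] := cofP dH; rewrite c0 IH ?andbT //=; last first.
  by move=> H' HH'; apply: dA; rewrite inE HH' orbT.
apply/allP => c /mapP[H' HH' ->].
have [c0' hc'] := cofP (dA H' (mem_behead (s := H :: A) HH')).
apply/negP => /(hp_eqE c0 c0'); rewrite hc hc' => E.
by rewrite E HH' in HA.
Qed.

(** Forms with the same kernel are proportional to the chosen one; the zero form does not occur, as
    its kernel V is not a hyperplane. *)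
Lemma rlog_cols (A : {fset {vspace 'rV[K]_l}}) g : arrangement A ->
  rlog (1%:M : 'M_l) fullv A g <-> logv (cols A) g.
Proof.
move=> arrA; split => [h c /mapP[H HA ->]|h c].
  have [c0 hc] := cofP (arrA H HA); have := h (cof H).
  by rewrite capvf hc mul1mx; apply.
rewrite capvf mul1mx => cA; have [c0 hc] := cofP (arrA _ cA).
have c1 : c != 0.
  apply/eqP => c0'; have := arrA _ cA.
  have -> : hp c = fullv.
    by apply/vspaceP => v; rewrite c0' mem_hp mulmx0 eqxx memvf.
  by rewrite dimvf /dim /= mul1n => /eqP; rewrite eqn_leq ltnn.
have /(hp_eqE c0 c1)/paraP[k kE] := hc; rewrite {1 2}kE lfZ.
have -> : cst l (k *: cof (hp c)) = k%:MP *: cst l (cof (hp c)).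
  by apply/matrixP => i j; rewrite !mxE mpolyCM.
rewrite -scalemxAr scale_mxE -mul_mpolyC; apply: mdvd_mul; first exact: mdvd_refl.
by apply: h; apply: map_f.
Qed.

Lemma memv_bigcap (C : seq {vspace 'rV[K]_l}) v :
  (v \in (\bigcap_(H <- C) H)%VS) = all (fun H : {vspace 'rV[K]_l} => v \in H) C.
Proof.
elim: C => [|H C IH]; first by rewrite big_nil memvf.
by rewrite big_cons memv_cap IH.
Qed.

(** Turns condition (1) of a MAT-step into full column rank. *)
Lemma row_full_dim t (W : 'M[K]_(l, t)) (X : {vspace 'rV[K]_l}) :
  (forall v, (v \in X) = (v *m W == 0)) -> (\dim X + t = l)%N -> \rank W = t.
Proof.
move=> XW dX; pose f : 'Hom('rV[K]_l, 'rV[K]_t) := linfun (mulmxr W).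
have XE : X = lker f by apply/vspaceP => v; rewrite XW memv_ker lfunE.
have := limg_ker_dim f fullv; rewrite capfv -XE dimvf /dim /= mul1n => E.
have /addnI df : (\dim X + \dim (limg f) = \dim X + t)%N by rewrite dX.
have full : limg f = fullv.
  by apply/eqP; rewrite eqEdim subvf dimvf /dim /= mul1n df.
have ex j : exists v : 'rV_l, v *m W = delta_mx 0 j.
  have : delta_mx 0 j \in limg f by rewrite full memvf.
  by case/memv_imgP => v _; rewrite lfunE /= => ->; exists v.
have [v vE] := choice ex; apply/eqP/row_fullP; exists (\matrix_j v j).
by apply/row_matrixP => j; rewrite row_mul rowK vE row1.
Qed.

Lemma decomp_mem m q (W : 'M[K]_(l, q)) (M : 'M_(m, l)) U C v :
  U *m M + W *m C = 1%:M -> M *m W = 0 -> (v <= M)%MS = (v *m W == 0 :> 'rV_q).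
Proof.
move=> E MW; apply/submxP/eqP => [[y ->]|vW]; first by rewrite -mulmxA MW mulmx0.
by exists (v *m U); rewrite -[LHS]mulmx1 -E mulmxDr !mulmxA vW mul0mx addr0.
Qed.

Lemma hp_cap2E (a c c' : 'cV[K]_l) : a != 0 -> ~~ para a c -> ~~ para a c' ->
  (hp c :&: hp a = hp c' :&: hp a)%VS <-> exists k k', c' = k *: c + k' *: a.
Proof.
move=> a0 ac ac'.
have ra := mxrank_col1 a0.
have [m lE] : exists m, l = (m + 1)%N.
  have := rank_leq_row a; rewrite ra => l0; exists l.-1; by rewrite addn1 prednK.
have [M [U [C [EM MU Ma _]]]] := decomp_ker lE ra.
have kerM b : M *m b = 0 -> b = (C *m b) 0 0 *: a.
  move=> Mb; rewrite -[LHS]mul1mx -EM mulmxDl -mulmxA Mb mulmx0 add0r -mulmxA.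
  by rewrite {1}[C *m b]mx11_scalar mul_mx_scalar.
have Mn b : ~~ para a b -> M *m b != 0.
  by apply: contraNneq => /kerM E; apply/paraP; eexists; apply: E.
have XM v : (v \in hp a) = (v <= M)%MS by rewrite mem_hp (decomp_mem _ EM Ma).
rewrite (hp_capE XM (Mn _ ac) (Mn _ ac')); split=> [/paraP[k kE]|[k [k' ->]]].
  have /kerM E' : M *m (c' - k *: c) = 0 by rewrite mulmxBr -scalemxAr kE subrr.
  by exists k; rewrite -(subrK (k *: c) c') E'; eexists; rewrite addrC.
by apply/paraP; exists k; rewrite mulmxDr -!scalemxAr Ma scaler0 addr0.
Qed.

Lemma card_imfset_undup (T : choiceType) (A : {fset {vspace 'rV[K]_l}})
    (F : {vspace 'rV[K]_l} -> T) :
  #|` [fset F H | H in A]%fset| = size (undup (map F A)).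
Proof.
apply: perm_size; apply: uniq_perm; rewrite ?undup_uniq ?fset_uniq //.
move=> z; rewrite mem_undup; apply/imfsetP/mapP => -[H HA ->]; by exists H.
Qed.

End Hyperplanes.

(** * Homogeneous bases with the top degree set apart *)

Section Stages.
Context (K : fieldType) (l : nat).
Local Notation V := 'rV[K]_l.
Local Notation S := {mpoly K[l]}.
Implicit Types (D Hs : {fset {vspace V}}) (G : 'M[S]_l) (d : 'I_l -> nat).

Lemma isbasis_ext m n (P P' : 'rV[{mpoly K[m]}]_m -> Prop) (G : 'M_(n, m)) :
  (forall g, P g <-> P' g) -> isbasis P G -> isbasis P' G.
Proof. by move=> h [h1 h2]; split=> [i|f /h /h2]; first exact/h. Qed.

Lemma logv_mem m (s s' : seq 'cV[K]_m) g : s =i s' -> logv s g <-> logv s' g.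
Proof. by move=> ss; split => h c cs; apply: h; rewrite ?ss // -ss. Qed.

Lemma exp_basis D G d : arrangement D -> isbasis (logv (cols D)) G -> hrows G d ->
  D_exp D = sort leq [seq d i | i : 'I_l].
Proof.
move=> arrD bG hG.
have := @exponents_basis K l l 1%:M 1%:M (mulmx1 _) _ idfun id
  (fun=> erefl) (fun=> erefl) idfun (fun q => esym (res1 q)) fullv D l G d _ hG.
by apply; apply: isbasis_ext bG => g; rewrite rlog_cols.
Qed.

(** The rows from index r on are those of largest degree E, and [r < l] says that E is attained; the
    first r rows come in any order. *)
Definition stage D G d r E : Prop :=
  [/\ isbasis (logv (cols D)) G, hrows G d, (r < l)%N,
      forall i : 'I_l, (i < r)%N -> (d i < E)%N
    & forall i : 'I_l, (r <= i)%N -> d i = E].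

Lemma stage_le D G d r E i : stage D G d r E -> (d i <= E)%N.
Proof. by case=> _ _ _ h1 h2; case: (ltnP i r) => [/h1/ltnW|/h2->]. Qed.

Lemma stage_max D G d r E : arrangement D -> stage D G d r E ->
  (\max_(e <- D_exp D) e)%N = E.
Proof.
move=> arrD st; have [bG hG rl _ h] := st; rewrite (exp_basis arrD bG hG).
rewrite (perm_big [seq d i | i : 'I_l]) ?perm_sort //= big_map big_enum /=.
apply/eqP; rewrite eqn_leq; apply/andP; split.
  by apply/bigmax_leqP => i _; apply: stage_le st.
by rewrite -[X in (X <= _)%N](h (Ordinal rl) (leqnn r)); apply: (bigop.leq_bigmax (Ordinal rl)).
Qed.

Lemma perm_initial (Q : pred 'I_l) :
  exists (p : 'S_l) (r : nat), (r <= l)%N /\ forall i : 'I_l, (i < r)%N = Q (p i).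
Proof.
pose L := filter Q (enum 'I_l) ++ filter (predC Q) (enum 'I_l).
have LE : perm_eq L (enum 'I_l) by apply: permEl; apply: perm_filterC.
have sL : size L = l by rewrite (perm_size LE) size_enum_ord.
have LU : uniq L by rewrite (perm_uniq LE) enum_uniq.
have inj : injective (fun i : 'I_l => nth i L i).
  move=> i j /=; rewrite (set_nth_default i) ?sL // => /eqP.
  by rewrite nth_uniq ?sL // => /eqP/val_inj.
exists (perm inj), (size (filter Q (enum 'I_l))); split.
  by rewrite size_filter (leq_trans (count_size _ _)) // size_enum_ord.
move=> i; rewrite permE nth_cat; case: ltnP => [ir|ri].
  have : nth i [seq x <- enum 'I_l | Q x] i \in [seq x <- enum 'I_l | Q x] by apply: mem_nth.
  by rewrite mem_filter => /andP[->].
have : nth i (filter (predC Q) (enum 'I_l)) (i - size (filter Q (enum 'I_l)))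
     \in filter (predC Q) (enum 'I_l).
  by apply: mem_nth; rewrite ltn_subLR // -size_cat -/L sL.
by rewrite mem_filter => /andP[/negPf->].
Qed.

Lemma stage_exists D : arrangement D -> (0 < l)%N -> D_free D ->
  exists G d r E, stage D G d r E.
Proof.
move=> arrD l0 [n [th bth]].
have pD : parr (cols D) by apply: parr_cols => //; exact: fset_uniq.
have dth i : derivation idfun (th i) by have [/(_ i)[]] := bth.
have bG : isbasis (logv (cols D)) (\matrix_i vec (m := l) idfun id (th i)).
  have := (@der_basisP K l l 1%:M _ idfun id (fun=> erefl) (fun=> erefl)
    idfun (fun q => esym (res1 q)) fullv D n th dth).1 bth.
  by apply: isbasis_ext => g; apply: rlog_cols.
have nl := isbasis_size pD bG; subst n.
have [G [d [{}bG hG]]] := homog_basis_exists pD bG.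
pose E := (\max_i d i)%N.
have dE i : (d i <= E)%N by apply: leq_bigmax.
have [p [r [rl pr]]] := perm_initial [pred i | d i < E]%N.
exists (row_perm p G), (d \o p), r, E; split.
- by rewrite row_permE; apply: isbasis_unit bG; apply: unitmx_perm.
- by move=> i j; rewrite mxE; apply: hG.
- rewrite ltn_neqAle rl andbT; apply/eqP => rE.
  have := @bigop.eq_bigmax _ d; rewrite card_ord => /(_ l0)[i iE].
  have := pr (p^-1 i)%g; rewrite permKV /= rE ltn_ord /E iE ltnn; discriminate.
- by move=> i; rewrite pr.
- move=> i ri; apply/eqP; rewrite eqn_leq dE leqNgt /=.
  by have := pr i; rewrite /= => <-; rewrite -leqNgt.
Qed.

Definition next_deg m E d : 'I_l -> nat := fun i => if (m <= i)%N then E.+1 else d i.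

(** Translates [mat_step_model] from forms to subspaces. [hh k], for k at least l - t, is the
    hyperplane of the block paired with row k, the only row not tangent to it. *)
Lemma mat_step_stage D Hs G d r E : arrangement D -> mat_step D Hs ->
  stage D G d r E ->
  let t := #|` Hs| in
  exists (p : 'S_l) (T : 'M[K]_l) (hh : 'I_l -> {vspace V}) (x : V),
  let G1 := cst l T *m row_perm p G in
  [/\ (r + t <= l)%N, forall i : 'I_l, (i < r)%N -> p i = i /\ row i G1 = row i G,
      forall i (k : 'I_l), (k < l - t)%N -> T i k = (i == k)%:R,
      isbasis (logv (cols D)) G1 & hrows G1 d] /\
  [/\ perm_eq Hs [seq hh k | k <- enum [pred k : 'I_l | (l - t <= k)%N]],
      forall i k : 'I_l, (l - t <= k)%N -> i != k ->
        mdvd (lf (cof (hh k))) ((G1 *m cst l (cof (hh k))) i 0),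
      forall k : 'I_l, (l - t <= k)%N -> evl x ((G1 *m cst l (cof (hh k))) k 0) != 0,
      forall k : 'I_l, (l - t <= k)%N -> x *m cof (hh k) = 0
    & forall H, H \in D -> x *m cof H != 0].
Proof.
move=> arrD [_ [arrH dis] dimX nX cond3] st t.
have [bG hG rl dlt deq] := st.
have pD : parr (cols D) by apply: parr_cols => //; exact: fset_uniq.
pose h j := nth fullv Hs j; pose W := \matrix_(i < l, j < t) cof (h j) i 0.
have colW j : col j W = cof (h j) by apply/colP => i; rewrite !mxE.
have hin (j : 'I_t) : h j \in Hs by apply: mem_nth.
have hpW (j : 'I_t) : cof (h j) != 0 /\ hp (cof (h j)) = h j.
  by apply: cofP; apply: arrH.
have XW v : (v \in (\bigcap_(H <- Hs) H)%VS) = (v *m W == 0).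
  rewrite memv_bigcap; apply/allP/eqP => [vH|vW H HH].
    apply/rowP => j; have := vH _ (hin j); rewrite -(hpW j).2 mem_hp -colW.
    by move/eqP/rowP/(_ 0); rewrite mulmx_colE !mxE.
  have jt : (index H Hs < t)%N by rewrite index_mem.
  have HE : h (Ordinal jt) = H by rewrite /h nth_index.
  rewrite -HE -(hpW (Ordinal jt)).2 mem_hp -colW mulmx_colE vW.
  by apply/eqP/colP => i; rewrite !mxE.
have rW := row_full_dim XW dimX.
have [x xW xD] : exists2 x : V, x *m W = 0 & forall H, H \in D -> x *m cof H != 0.
  apply: contrapT => nx; apply: nX => v; rewrite XW => /eqP vW.
  apply: contrapT => nv; apply: nx; exists v => // H HD.
  by apply/eqP => vc; apply: nv; exists H; rewrite // -(cofP (arrD H HD)).2 mem_hp vc.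
have xs c : c \in cols D -> x *m c != 0 by case/mapP => H HD ->; apply: xD.
have nW j c : c \in cols D -> ~~ para (col j W) c.
  move=> /xs; apply: contra => /paraP[k ->].
  by rewrite -scalemxAr mulmx_colE xW col0 scaler0.
have [||p [T [[rtl pr T1 bG1 hG1] [al [nz rows]]]]] := mat_step_model
  (f := fun j c => (hp c :&: hp (col j W))%VS) pD bG hG (ltnW rl) dlt deq rW xW xs.
- move=> j c c' cD cD'; apply: hp_cap2E; rewrite ?nW //.
  by rewrite colW (hpW j).1.
- move=> j; rewrite -(stage_max arrD st) -(cond3 _ (hin j)) /cols size_map.
  rewrite card_imfset_undup -map_comp; congr (_ - size (undup _))%N.
  by apply/eq_in_map => H HD /=; rewrite colW (hpW j).2 (cofP (arrD H HD)).2.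
have tl : (t <= l)%N by lia.
(* Below l - t the truncated subtraction yields 0, a mere default. *)
pose idx (k : 'I_l) := (k - (l - t))%N.
exists p, T, (fun k => h (idx k)), x; split; first by split => // i ir; rewrite pr ?rows.
have jt (k : 'I_l) : (l - t <= k)%N -> exists2 j : 'I_t, h (idx k) = h j & k = (l - t + j)%N :> nat.
  move=> kt; have kk : (idx k < t)%N by rewrite /idx; have := ltn_ord k; lia.
  by exists (Ordinal kk) => //=; rewrite /idx subnKC.
have colE' i (j : 'I_t) : (cst l T *m row_perm p G *m cst l (cof (h j))) i 0
    = (cst l T *m row_perm p G *m cst l W) i j.
  by rewrite -colW /cst map_col mulmx_colE mxE.
split => //.
- apply: uniq_perm; rewrite ?fset_uniq //.
    rewrite map_inj_in_uniq ?enum_uniq // => k k'; rewrite !mem_enum !inE.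
    move=> /jt[j -> kE] /jt[j' -> kE'] /eqP; rewrite nth_uniq ?fset_uniq //.
    by move=> /eqP jj; apply: val_inj; rewrite /= kE kE' jj.
  move=> H; apply/idP/mapP => [HH|[k]].
    have jH : (index H Hs < t)%N by rewrite index_mem.
    have kl : (l - t + index H Hs < l)%N by lia.
    exists (Ordinal kl); first by rewrite mem_enum inE /= leq_addr.
    by rewrite /h /idx /= addKn nth_index.
  by rewrite mem_enum inE => /jt[j -> _] ->.
- move=> i k /jt[j -> kE] ik; rewrite colE' -colW; apply: al => iE.
  by case/eqP: ik; apply: val_inj; rewrite /= iE kE.
- by move=> k /jt[j -> kE]; rewrite colE'; apply: nz.
- by move=> k /jt[j -> kE]; rewrite -colW mulmx_colE xW col0.
Qed.

End Stages.

(** * Iterated steps and restriction to X *)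

Section Chain.
Context (K : fieldType) (l : nat).
Local Notation V := 'rV[K]_l.
Local Notation S := {mpoly K[l]}.
Implicit Types (D Hs : {fset {vspace V}}) (G : 'M[S]_l) (d : 'I_l -> nat).
Implicit Types (hh : 'I_l -> {vspace V}) (P : pred 'I_l).

Definition scaled P hh G : 'M[S]_l :=
  \matrix_(i, j) ((if P i then lf (cof (hh i)) else 1) * G i j).

Definition adjoin D P hh : seq {vspace V} := D ++ [seq hh k | k <- enum P].

Lemma parr_adjoin D P hh : arrangement D ->
  (forall k, P k -> (\dim (hh k)).+1 = l /\ hh k \notin D) ->
  {in P &, injective hh} -> parr (cols (adjoin D P hh)).
Proof.
move=> arrD hP inj; apply: parr_cols; last first.
  move=> H; rewrite mem_cat => /orP[/arrD //|/mapP[k]].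
  by rewrite mem_enum => /hP[dk _] ->.
rewrite cat_uniq fset_uniq map_inj_in_uniq ?enum_uniq ?andbT /=; last first.
  by move=> k k'; rewrite !mem_enum; apply: inj.
by apply/hasPn => H /mapP[k]; rewrite mem_enum => /hP[_ h] ->.
Qed.

Lemma basis_adjoin D P hh G : arrangement D -> isbasis (logv (cols D)) G ->
  parr (cols (adjoin D P hh)) ->
  (forall i k, P k -> i != k ->
     mdvd (lf (cof (hh k))) ((G *m cst l (cof (hh k))) i 0)) ->
  isbasis (logv (cols (adjoin D P hh))) (scaled P hh G).
Proof.
move=> arrD bG pa al; have pD : parr (cols D).
  by apply: parr_cols => //; apply: fset_uniq.
have := scale_basis (aa := fun k => cof (hh k)) (P := P) pD _ bG al.
by rewrite /cols /adjoin map_cat -map_comp in pa *; apply.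
Qed.

(** Since the block is nonempty, the degree E + 1 is attained; the rows left at degree E now count
    as small, and r moves up to l - |Hs|. *)
Lemma stage_next D Hs hh G d r E : arrangement D -> arrangement Hs ->
  [disjoint Hs & D]%fset -> Hs != fset0 -> isbasis (logv (cols D)) G ->
  hrows G d -> let m := (l - #|` Hs|)%N in (r + #|` Hs| <= l)%N ->
  (forall i, (d i <= E)%N) -> (forall i : 'I_l, (r <= i)%N -> d i = E) ->
  perm_eq Hs [seq hh k | k <- enum [pred k : 'I_l | (m <= k)%N]] ->
  (forall i k : 'I_l, (m <= k)%N -> i != k ->
     mdvd (lf (cof (hh k))) ((G *m cst l (cof (hh k))) i 0)) ->
  stage (D `|` Hs)%fset (scaled [pred k : 'I_l | (m <= k)%N] hh G)
    (next_deg m E d) m E.+1.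
Proof.
move=> arrD arrH dis H0 bG hG m rl dE deq pH al.
have Hin (k : 'I_l) : (m <= k)%N -> hh k \in Hs.
  by move=> mk; rewrite (perm_mem pH) map_f // mem_enum.
have t0 : (0 < #|` Hs|)%N by rewrite cardfs_gt0.
have dis' H : H \in Hs -> H \notin D.
  by move=> HH; apply: (fdisjointP dis).
split.
- have : isbasis (logv (cols (adjoin D [pred k : 'I_l | (m <= k)%N] hh)))
      (scaled [pred k : 'I_l | (m <= k)%N] hh G).
    apply: basis_adjoin => //; apply: parr_adjoin => //.
      by move=> k /Hin kH; rewrite arrH // dis'.
    by apply/dinjectiveP; rewrite /dinjectiveb -(perm_uniq pH) fset_uniq.
  apply: isbasis_ext => g; apply: logv_mem; apply: eq_mem_map => H.
  by rewrite mem_cat !inE (perm_mem pH).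
- move=> i j; rewrite mxE /next_deg /=; case: ifP => mi; last by rewrite mul1r.
  have -> : E = d i by rewrite deq //; move: mi; rewrite /m; lia.
  by rewrite -[(d i).+1]add1n; apply: dhomogM; [apply: lf_homog|apply: hG].
- by rewrite /m; lia.
- by move=> i im; rewrite /next_deg ifN ?ltnS // -ltnNge.
- by move=> i im; rewrite /next_deg ifT.
Qed.

(** A step alters only rows of the current top degree, and both the index r and that degree can only
    grow; so the rows below r are final. *)
Lemma stage_tail (A H : nat -> {fset {vspace V}}) (n : nat) :
  (forall j, (j <= n)%N -> arrangement (A j)) ->
  (forall j, (j < n)%N -> A j.+1 = A j `|` H j.+1)%fset ->
  (forall j, (j < n)%N -> mat_step (A j) (H j.+1)) ->
  (forall j, (j < n)%N -> H j.+1 != fset0) ->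
  forall k j G d r E, (k <= j <= n)%N -> stage (A k) G d r E ->
  exists G' d' r' E', [/\ stage (A j) G' d' r' E', (r <= r')%N, (E <= E')%N,
    forall i : 'I_l, (i < r)%N -> row i G' = row i G /\ d' i = d i
    & forall i : 'I_l, (r <= i)%N -> (E <= d' i)%N].
Proof.
move=> arrA AE matA H0 k j G d r E /andP[kj jn] st.
elim: j kj jn => [|j IH].
  rewrite leqn0 => /eqP k0 _; exists G, d, r, E; rewrite -{1}k0; split => //.
  by move=> i ri; case: st => _ _ _ _ ->.
rewrite leq_eqVlt => /orP[/eqP kE|kj] jn.
  exists G, d, r, E; rewrite -{1}kE; split => //.
  by move=> i ri; case: st => _ _ _ _ ->.
have [G' [d' [r' [E' [st' rr EE rows dd]]]]] := IH kj (ltnW jn).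
have arrj := arrA _ (ltnW jn).
have [p [T [hh [x [[rt pr T1 bG1 hG1] [pH al _ _ _]]]]]] :=
  mat_step_stage arrj (matA _ jn) st'.
have [_ [arrH dis] _ _ _] := matA _ jn.
have [_ _ _ _ deq'] := st'.
have := stage_next arrj arrH dis (H0 _ jn) bG1 hG1 rt
  (fun i => stage_le i st') deq' pH al.
rewrite -AE // => st2; do 4!eexists; split; first exact: st2.
- lia.
- lia.
- move=> i ir; have [rw de] := rows i ir; have ir' := leq_trans ir rr.
  have ni : (l - #|` H j.+1| <= i)%N = false by lia.
  split; last by rewrite /next_deg ni.
  have [_ r1] := pr i ir'; rewrite -rw -r1; apply/rowP => u.
  by rewrite 2!mxE /= ni mul1r [RHS]mxE.
move=> i ri; rewrite /next_deg; case: ifP => _; last exact: dd.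
exact: leq_trans EE (leqnSn _).
Qed.

Lemma isbasis_castmx m n n' (e : n = n') (Q : 'rV[{mpoly K[m]}]_m -> Prop)
    (B : 'M_(n, m)) : isbasis Q B -> isbasis Q (castmx (e, erefl m) B).
Proof. by case: n' / e; rewrite castmx_id. Qed.

(** If a basis of a module lies in a submodule, the two coincide; this yields D(A^X) = D(A_k^X). *)
Lemma isbasis_sub m n (Q Q' : 'rV[{mpoly K[m]}]_m -> Prop) (B : 'M_(n, m)) :
  (forall i, Q' (row i B)) -> (forall g, Q' g -> Q g) -> isbasis Q B -> isbasis Q' B.
Proof. by move=> h1 h2 [_ h]; split=> // g /h2/h. Qed.

(** D is the arrangement before the block, A the final one, and C consists of the [hh k] with k at
    least l - q. The rows of [G5] below l - q may differ from the scaled basis by multiples of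
    equations of X, which restriction removes. *)
Lemma restrict_piece D A hh G G5 x (a q : nat) :
  arrangement D -> arrangement A -> (q <= l)%N -> (a <= l - q)%N ->
  (D `<=` A)%fset ->
  (forall k : 'I_l, (a <= k)%N -> [/\ hh k \in A, hh k \notin D & x *m cof (hh k) = 0]) ->
  {in [pred k : 'I_l | (a <= k)%N] &, injective hh} ->
  isbasis (logv (cols D)) G ->
  (forall i k : 'I_l, (a <= k)%N -> i != k ->
     mdvd (lf (cof (hh k))) ((G *m cst l (cof (hh k))) i 0)) ->
  (forall k : 'I_l, (a <= k)%N -> evl x ((G *m cst l (cof (hh k))) k 0) != 0) ->
  (forall H, H \in D -> x *m cof H != 0) ->
  isbasis (logv (cols A)) G5 ->
  (forall i j : 'I_l, (i < l - q)%N -> exists h : 'I_l -> S,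
     G5 i j = scaled [pred k : 'I_l | (a <= k < l - q)%N] hh G i j
       + \sum_(k : 'I_l | (l - q <= k)%N) h k * lf (cof (hh k))) ->
  forall X : {vspace V},
  (forall v, v \in X <-> forall k : 'I_l, (l - q <= k)%N -> v \in hh k) ->
  exists (M : 'M[K]_(l - q, l)) (U : 'M[K]_(l, l - q)) (W : 'M[K]_(l, q)) (C : 'M[K]_(q, l)),
  [/\ [/\ U *m M + W *m C = 1%:M, M *m U = 1%:M & M *m W = 0],
      forall v, (v \in X) = (v <= M)%MS,
      forall j, exists2 k : 'I_l, (l - q <= k)%N & col j W = cof (hh k)
    & isbasis (rlog M X (restriction A X))
        (map_mx (res M) (\matrix_i row (widen_ord (leq_subr q l) i) G5) *m cst (l - q) U)].
Proof.
move=> arrD arrA ql aq DA hhP inj bG al nz xD bG5 G5E X XE.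
have lE : l = (l - q + q)%N by rewrite subnK.
have hhc (k : 'I_l) : (a <= k)%N -> cof (hh k) != 0 /\ hp (cof (hh k)) = hh k.
  by move=> /hhP[kA _ _]; apply: cofP; apply: arrA.
have idx_lt (j : 'I_q) : (l - q + j < l)%N by have := ltn_ord j; lia.
pose idx (j : 'I_q) := Ordinal (idx_lt j).
have idxq j : (l - q <= idx j)%N by rewrite /= leq_addr.
have idxa j : (a <= idx j)%N by apply: leq_trans aq (idxq j).
have idxS (k : 'I_l) : (l - q <= k)%N -> exists j, k = idx j.
  move=> qk; have kq : (k - (l - q) < q)%N by have := ltn_ord k; lia.
  by exists (Ordinal kq); apply: val_inj; rewrite /= subnKC.
have idx_inj : injective idx.
  by move=> j j' /(congr1 val) /= /eqP; rewrite eqn_add2l => /eqP/val_inj.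
pose W := \matrix_(i < l, j < q) cof (hh (idx j)) i 0.
have colW j : col j W = cof (hh (idx j)) by apply/colP => i; rewrite !mxE.
have GW i j : (G *m cst l W) i j = (G *m cst l (cof (hh (idx j)))) i 0.
  by rewrite -colW /cst map_col mulmx_colE [RHS]mxE.
have xW : x *m W = 0.
  apply/rowP => j; have [_ _ /rowP/(_ 0)] := hhP _ (idxa j).
  by rewrite -colW mulmx_colE !mxE.
have evlGW i j : i != idx j -> evl x ((G *m cst l W) i j) = 0.
  move=> ij; rewrite GW; have [h ->] := al i _ (idxa j) ij.
  have [_ _ xk] := hhP _ (idxa j).
  by rewrite rmorphM /= evl_lf xk mxE mul0r.
pose z := \row_j evl x ((G *m cst l W) (idx j) j).
(* At x the last q rows take a diagonal form with nonzero entries. This gives both the rank of W and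
   the determinant that must not vanish on X. *)
have zP : map_mx (evl x) (rowsub idx G *m cst l W) = diag_mx z.
  apply/matrixP => i j; rewrite map_mx_entry.
  have -> : (rowsub idx G *m cst l W) i j = (G *m cst l W) (idx i) j.
    by rewrite mul_rowsub_mx mxE.
  rewrite [RHS]mxE; have [->|ij] := eqVneq i j; first by rewrite mulr1n [RHS]mxE.
  by rewrite mulr0n evlGW // (inj_eq idx_inj).
have z0 : \det (diag_mx z) != 0.
  rewrite det_diag; apply/prodf_neq0 => j _; rewrite mxE GW; exact: nz.
have rW : \rank W = q.
  apply/eqP; rewrite eqn_leq rank_leq_col /=.
  have rz : \rank (diag_mx z) = q by apply: mxrank_unit; rewrite unitmxE unitfE.
  by rewrite -[X in (X <= _)%N]rz -zP map_mxM /= evl_cst mxrankM_maxr.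
have [M [U [C [EM MU MW CW]]]] := decomp_ker lE rW.
exists M, U, W, C.
have XM v : (v \in X) = (v <= M)%MS.
  rewrite (decomp_mem _ EM MW); apply/idP/eqP => [/XE vX|vW].
    apply/rowP => j; have := vX _ (idxq j); rewrite -(hhc _ (idxa j)).2 mem_hp.
    by rewrite -colW mulmx_colE => /eqP/rowP/(_ 0); rewrite !mxE.
  apply/XE => k /idxS[j ->]; rewrite -(hhc _ (idxa j)).2 mem_hp -colW.
  by rewrite mulmx_colE vW col0.
split => //; first by move=> j; exists (idx j).
(* Only block members outside C are adjoined: [s] consists of the hyperplanes, up to this block,
   that do not contain X. *)
pose P := [pred k : 'I_l | (a <= k < l - q)%N].
pose s := cols (adjoin D P hh); pose Y := scaled P hh G.
have ps : parr s.
  apply: parr_adjoin => // [k /andP[/hhP[kA kD _] _]|k k' /andP[ka _] /andP[ka' _]].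
    by rewrite arrA.
  exact: inj.
have bY : isbasis (logv s) Y.
  by apply: basis_adjoin => // i k /andP[ka _]; apply: al.
have xM : exists y, x = y *m M.
  by apply/submxP; rewrite (decomp_mem _ EM MW) xW.
have [y yM] := xM.
have Ms c : c \in s -> M *m c != 0.
  case/mapP => H; rewrite mem_cat => /orP[HD ->|/mapP[k]].
    by have := xD _ HD; apply: contraNneq; rewrite yM -mulmxA => ->; rewrite mulmx0.
  (* If [hh k] contained X, its form would be a combination of columns of W, and the value of row k
     at x would be zero. *)
  rewrite mem_enum => /andP[ka kq] -> ->; have := nz _ ka; apply: contraNneq => Mc.
  have -> : cof (hh k) = W *m (C *m cof (hh k)).
    by rewrite mulmxA -[LHS]mul1mx -EM mulmxDl -mulmxA Mc mulmx0 add0r.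
  rewrite cstM mulmxA mxE rmorph_sum big1 //= => j _; rewrite rmorphM /= evlGW ?mul0r //.
  by apply: contraTneq (idxq j) => <-; rewrite -ltnNge.
have [sX [psX cov mem _]] := class_reps (f := fun c => (hp c :&: X)%VS) Ms
  (fun c c' cs cs' => hp_capE XM (Ms c cs) (Ms c' cs')).
pose w (i : 'I_(l - q)) : 'I_l := widen_ord (leq_subr q l) i.
pose Y' := castmx (lE, erefl l) Y; pose Y1 := usubmx Y'; pose Y2 := dsubmx Y'.
have Y1E i j : Y1 i j = Y (w i) j.
  rewrite !mxE castmxE /= cast_ord_id mxE.
  by have -> : cast_ord (esym lE) (lshift q i) = w i by apply: val_inj.
have Y2E : Y2 = rowsub idx G.
  apply/matrixP => i j; rewrite !mxE castmxE /= cast_ord_id mxE.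
  have -> : cast_ord (esym lE) (rshift (l - q) i) = idx i by apply: val_inj.
  by rewrite /= ltnNge leq_addr andbF mul1r.
have resk (k : 'I_l) : (l - q <= k)%N -> res M (lf (cof (hh k))) = 0.
  by move=> /idxS[j ->]; rewrite res_lf -colW mulmx_colE MW col0 lf0.
have Y1W : map_mx (res M) (Y1 *m cst l W) = 0.
  apply/matrixP => i j; rewrite map_mx_entry [RHS]mxE.
  have -> : (Y1 *m cst l W) i j
      = (if P (w i) then lf (cof (hh (w i))) else 1) * (G *m cst l W) (w i) j.
    rewrite mxE [in RHS]mxE mulr_sumr; apply: eq_bigr => u _.
    by rewrite Y1E mxE mulrA.
  have ij : w i != idx j.
    by apply: contraTneq (idxq j) => <-; rewrite -ltnNge /=.
  rewrite GW; have [h ->] := al _ _ (idxa j) ij.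
  by rewrite !rmorphM /= resk // mul0r mulr0.
have Y2W : \det (map_mx (res M) (Y2 *m cst l W)) != 0.
  apply: contraNneq z0 => d0; rewrite -zP -Y2E.
  have -> : map_mx (evl x) (Y2 *m cst l W)
      = map_mx (evl y) (map_mx (res M) (Y2 *m cst l W)).
    by apply/matrixP => i j; rewrite !map_mx_entry evl_res yM.
  by rewrite det_map_mx d0 rmorph0.
pose Z := map_mx (res M) Y1 *m cst (l - q) U.
have bZ : isbasis (logv sX) Z.
  apply: (restr_basis (s := s) (Y2 := Y2) lE EM MW ps psX) => //.
  - by move=> c cs; split; [apply: Ms|apply: cov].
  - move=> k /mem[c cs ->]; exists c => //.
    by apply/paraP; exists 1; rewrite scale1r.
  - by rewrite vsubmxK; apply: isbasis_castmx.
have ZM : Z *m cst (l - q) M = map_mx (res M) Y1.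
  rewrite -mulmxA -cstM -[RHS]mulmx1 -(cst1 K) -EM /cst map_mxD -!/(cst _ _).
  rewrite mulmxDr [in X in _ + X]cstM [in X in _ + X]mulmxA.
  by move: Y1W; rewrite map_mxM res_cst => ->; rewrite mul0mx addr0.
have G5Y : map_mx (res M) (\matrix_i row (w i) G5) = map_mx (res M) Y1.
  apply/matrixP => i j; rewrite !map_mx_entry Y1E mxE mxE.
  have [|h ->] := G5E (w i) j; first exact: (ltn_ord i).
  rewrite rmorphD rmorph_sum big1 ?addr0 // => k kq.
  by rewrite rmorphM /= resk // mulr0.
rewrite G5Y -/Z; apply: isbasis_sub bZ.
- move=> i c /imfsetP[H /=]; rewrite inE => /andP[HA XH] cH.
  have [c1 hc1] := cofP (arrA H HA).
  have Mc1 : M *m cof H != 0 by rewrite -(sub_hpE _ XM) hc1.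
  have Mc : M *m c != 0.
    rewrite -(sub_hpE _ XM); apply: contra XH => /capv_idPr.
    by rewrite cH => <-; apply: capvSl.
  rewrite -hc1 in cH; have /paraP[k ->] := (hp_capE XM Mc1 Mc).1 (esym cH).
  rewrite lfZ -mul_mpolyC.
  have -> : cst (l - q) (k *: (M *m cof H)) = k%:MP *: (cst _ M *m cst _ (cof H)).
    by rewrite -cstM; apply/matrixP => u v; rewrite !mxE mpolyCM.
  rewrite -scalemxAr scale_mxE; apply: mdvd_mul; first exact: mdvd_refl.
  rewrite mulmxA -row_mul ZM -G5Y -(res_cst M) -map_row -map_mxM map_mx_entry.
  rewrite -res_lf; apply: (mdvd_morph (res M)); rewrite rowK.
  have [h _] := bG5; apply: h; exact: map_f.
- move=> g hg k /mem[c /mapP[H]]; rewrite mem_cat => HH -> ->.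
  have HA : H \in A.
    move: HH => /orP[/(fsubsetP DA) //|/mapP[k']]; rewrite mem_enum.
    by move=> /andP[/hhP[? _ _] _] ->.
  have Hs : cof H \in s by apply: map_f; rewrite mem_cat.
  have [c1 hc1] := cofP (arrA H HA).
  apply: hg; rewrite hc1; apply/imfsetP; exists H => //=.
  by rewrite inE HA -hc1 (sub_hpE _ XM) Ms.
Qed.

End Chain.

(** * The choice of C inside a block *)

Section Blocks.
Context (K : fieldType) (l : nat).
Local Notation V := 'rV[K]_l.
Local Notation S := {mpoly K[l]}.

Lemma perm_ge (p : 'S_l) m : (forall i : 'I_l, (i < m)%N -> p i = i) ->
  forall i : 'I_l, (m <= p i)%N = (m <= i)%N.
Proof.
move=> h i; rewrite [LHS]leqNgt [RHS]leqNgt; congr (~~ _); apply/idP/idP => [pi|im]; last by rewrite h.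
by have /perm_inj E := h _ pi; rewrite E in pi.
Qed.

Lemma card_ord_ge q : (q <= l)%N -> #|[pred k : 'I_l | (l - q <= k)%N]| = q.
Proof.
move=> ql; have := cardC [pred k : 'I_l | (k < l - q)%N].
have -> : #|[pred k : 'I_l | (k < l - q)%N]| = (l - q)%N.
  rewrite -sum1_card /= -(big_ord_widen l (fun=> 1%N)) ?leq_subr //.
  by rewrite sum_nat_const card_ord muln1.
have -> : #|[predC [pred k : 'I_l | (k < l - q)%N]]| = #|[pred k : 'I_l | (l - q <= k)%N]|.
  by apply: eq_card => k; rewrite !inE /= -leqNgt.
by rewrite card_ord; lia.
Qed.

Section Sequence.
Context (A H : nat -> {fset {vspace V}}) (n : nat).
Hypothesis arrA : forall j, (j <= n)%N -> arrangement (A j).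
Hypothesis AE : forall j, (j < n)%N -> (A j.+1 = A j `|` H j.+1)%fset.
Hypothesis matA : forall j, (j < n)%N -> mat_step (A j) (H j.+1).
Hypothesis H0 : forall j, (j < n)%N -> H j.+1 != fset0.
Hypothesis Hn : H n.+1 = fset0.

Lemma chain_sub j k : (j <= k <= n)%N -> (A j `<=` A k)%fset.
Proof.
move=> /andP[jk kn]; elim: k jk kn => [|k IH]; first by rewrite leqn0 => /eqP ->.
rewrite leq_eqVlt => /orP[/eqP -> //|jk] kn; rewrite AE //.
by apply: fsubset_trans (IH jk (ltnW kn)) _; apply: fsubsetUl.
Qed.

(** With u the size of the next block, the first l - u rows undergo just the change of basis of the
    next step, which adds multiples of the last u rows. For k = n the block is empty and all l rows
    are final. *)
Lemma later_rows k (G : 'M[S]_l) d m E : (k <= n)%N -> stage (A k) G d m E ->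
  exists (p : 'S_l) (T : 'M[K]_l) (G' : 'M[S]_l) d',
  [/\ isbasis (logv (cols (A n))) G', hrows G' d',
      forall i : 'I_l, (i < m)%N -> p i = i,
      forall i k' : 'I_l, (k' < l - #|` H k.+1|)%N -> T i k' = (i == k')%:R
    & forall i : 'I_l, if (i < l - #|` H k.+1|)%N
        then row i G' = row i (cst l T *m row_perm p G) /\ d' i = d i
        else (E <= d' i)%N].
Proof.
rewrite leq_eqVlt => /orP[/eqP -> |kn] st; have [bG hG ml _ deq] := st.
  exists 1%g, 1%:M, G, d; split => //; first by move=> i _; rewrite perm1.
    by move=> i k' _; rewrite mxE.
  by move=> i; rewrite Hn cardfs0 subn0 ltn_ord cst1 mul1mx row_perm1.
have arrk := arrA (ltnW kn).
have [p [T [hh [x [[rt pr T1 bG1 hG1] [pH al _ _ _]]]]]] :=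
  mat_step_stage arrk (matA kn) st.
have [_ [arrH dis] _ _ _] := matA kn.
have := stage_next arrk arrH dis (H0 kn) bG1 hG1 rt (fun i => stage_le i st) deq pH al.
rewrite -AE // => st2.
have [|G' [d' [r' [E' [[bG' hG' _ _ _] rr EE rows dd]]]]] :=
  stage_tail arrA AE matA H0 (j := n) _ st2; first by rewrite kn /=.
exists p, T, G', d'; split => //; first by move=> i /pr[].
move=> i; case: ltnP => ir; last exact: leq_trans (leqnSn E) (dd _ ir).
have ni : (l - #|` H k.+1| <= i)%N = false by lia.
have [-> ->] := rows _ ir; rewrite /next_deg ni; split => //.
by apply/rowP => u; rewrite 2!mxE /= ni mul1r [RHS]mxE.
Qed.

(** C is formed by the hyperplanes paired with the last q rows after the permutation of the next
    step; as q is at least u, it contains the u pivots. *)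
Lemma block_restriction G0 d0 r0 E0 k q : stage (A 0) G0 d0 r0 E0 -> (k < n)%N ->
  (#|` H k.+2| <= q <= #|` H k.+1|)%N ->
  exists2 C : {fset {vspace V}}, (C `<=` H k.+1)%fset /\ #|` C| = q &
  let X := (\bigcap_(Y <- C) Y)%VS in
  exists (G : 'M[S]_l) d (M : 'M[K]_(l - q, l)) (U : 'M[K]_(l, l - q))
    (W : 'M[K]_(l, q)) (N : 'M[K]_(q, l)),
  [/\ [/\ U *m M + W *m N = 1%:M, M *m U = 1%:M & M *m W = 0],
      forall v, (v \in X) = (v <= M)%MS,
      forall j, exists2 Y, Y \in C & col j W = cof Y,
      [/\ isbasis (logv (cols (A n))) G, hrows G d &
          forall i i' : 'I_l, (i < l - q <= i')%N -> (d i <= d i')%N]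
    & isbasis (rlog M X (restriction (A n) X))
        (map_mx (res M) (\matrix_i row (widen_ord (leq_subr q l) i) G) *m cst (l - q) U)].
Proof.
move=> st0 kn /andP[uq qt].
have [|G [d [r [E [st _ _ _ _]]]]] := stage_tail arrA AE matA H0 (j := k) _ st0.
  by rewrite /= ltnW.
have arrk := arrA (ltnW kn); have [bG hG rl _ deq] := st.
have [p [T [hh [x [[rt pr T1 bG1 hG1] [pH al nz xhh xD]]]]]] :=
  mat_step_stage arrk (matA kn) st.
have [_ [arrH dis] _ _ _] := matA kn.
set G1 := cst l T *m row_perm p G in bG1 hG1 al nz.
have := stage_next arrk arrH dis (H0 kn) bG1 hG1 rt (fun i => stage_le i st) deq pH al.
set m := (l - #|` H k.+1|)%N in T1 pH al nz xhh *.
set G2 := scaled _ hh G1; set d2 := next_deg m E d; rewrite -AE // => st2.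
have [p' [T' [G5 [d5 [bG5 hG5 pr' T1' rows]]]]] := later_rows kn st2.
have pge := perm_ge pr'.
have ql : (q <= l)%N by lia.
have mq : (m <= l - q)%N by rewrite /m; lia.
(* Each hyperplane follows its row through the permutation of the next step. *)
pose hh' k' := hh (p' k').
have hin (k' : 'I_l) : (m <= k')%N -> hh k' \in H k.+1.
  by move=> mk; rewrite (perm_mem pH) map_f // mem_enum.
have hh'in (k' : 'I_l) : (m <= k')%N -> hh' k' \in H k.+1.
  by move=> mk; apply: hin; rewrite pge.
have inj : {in [pred k' : 'I_l | (m <= k')%N] &, injective hh}.
  by apply/dinjectiveP; rewrite /dinjectiveb -(perm_uniq pH) fset_uniq.
have inj' : {in [pred k' : 'I_l | (m <= k')%N] &, injective hh'}.
  move=> i j im jm /inj E'; apply: (@perm_inj _ p'); apply: E'; by rewrite inE pge.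
pose sC := [seq hh' k' | k' <- enum [pred k' : 'I_l | (l - q <= k')%N]].
pose C : {fset {vspace V}} := [fset Y in sC]%fset.
have CE Y : (Y \in C) = (Y \in sC) by rewrite inE.
have sCU : uniq sC.
  rewrite map_inj_in_uniq ?enum_uniq // => i j; rewrite !mem_enum => iq jq.
  by apply: inj'; rewrite inE; apply: leq_trans mq _.
have rowE i j c : (row_perm p' G1 *m c) i j = (G1 *m c) (p' i) j :> S.
  by rewrite !mxE; apply: eq_bigr => u _; rewrite mxE.
exists C.
  split; last by rewrite card_fseq undup_id // size_map -cardE card_ord_ge.
  apply/fsubsetP => Y; rewrite CE => /mapP[k']; rewrite mem_enum => k'q ->.
  by apply: hh'in; apply: leq_trans mq _.
move=> X.
have hh'P (k' : 'I_l) : (m <= k')%N ->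
    [/\ hh' k' \in A n, hh' k' \notin A k & x *m cof (hh' k') = 0].
  move=> mk; have k'H := hh'in _ mk; split.
  - by apply: (fsubsetP (@chain_sub k.+1 n _)); rewrite ?kn ?leqnn // AE // inE k'H orbT.
  - exact: (fdisjointP dis).
  - by apply: xhh; rewrite pge.
have bG1' : isbasis (logv (cols (A k))) (row_perm p' G1).
  by rewrite row_permE; apply: isbasis_unit bG1; apply: unitmx_perm.
have al' (i k' : 'I_l) : (m <= k')%N -> i != k' ->
    mdvd (lf (cof (hh' k'))) ((row_perm p' G1 *m cst l (cof (hh' k'))) i 0).
  by move=> mk ik; rewrite rowE; apply: al; rewrite ?pge // (inj_eq perm_inj).
have nz' (k' : 'I_l) : (m <= k')%N ->
    evl x ((row_perm p' G1 *m cst l (cof (hh' k'))) k' 0) != 0.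
  by move=> mk; rewrite rowE; apply: nz; rewrite pge.
have G5E (i j : 'I_l) : (i < l - q)%N -> exists h : 'I_l -> S,
     G5 i j = scaled [pred k' : 'I_l | (m <= k' < l - q)%N] hh' (row_perm p' G1) i j
       + \sum_(k' : 'I_l | (l - q <= k')%N) h k' * lf (cof (hh' k')).
  move=> iq; have := rows i; rewrite ifT; last by lia.
  case=> /rowP/(_ j) + _; rewrite 2!mxE mxE => ->.
  (* Whatever the next step adds to row i comes from rows of index at least l - q, each carrying the
     form of a member of C as a factor. *)
  exists (fun k' => (T' i k')%:MP * G1 (p' k') j).
  rewrite (bigID [pred k' : 'I_l | (k' < l - q)%N]) /=; congr (_ + _).
    rewrite (bigD1 i) //= big1 ?addr0 => [|k' /andP[k'q k'i]]; last first.
      by rewrite mxE T1' 1?eq_sym ?(negPf k'i) ?mpolyC0 ?mul0r //; lia.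
    rewrite mxE T1'; last by lia.
    by rewrite eqxx mpolyC1 mul1r !mxE /= pge iq andbT.
  apply: eq_big => [k'|k' k'q]; first by rewrite -leqNgt.
  rewrite mxE [row_perm _ _ _ _]mxE mxE /= pge ifT; last by lia.
  by rewrite -mulrA; congr (_ * _); apply: mulrC.
have XE v : v \in X <-> forall k' : 'I_l, (l - q <= k')%N -> v \in hh' k'.
  rewrite memv_bigcap; split => [/allP h k' k'q|h].
    by apply: h; rewrite CE map_f // mem_enum.
  by apply/allP => Y; rewrite CE => /mapP[k']; rewrite mem_enum => /h vk ->.
have [M [U [W [N [dec XM Wc bZ]]]]] := restrict_piece arrk (arrA (leqnn n)) ql mq
  (chain_sub (j := k) (k := n) ltac:(by rewrite leqnn ltnW)) hh'P inj' bG1' al' nz' xD bG5 G5E XE.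
exists G5, d5, M, U, W, N; split => //; last first.
  (* All degrees are at most E + 1 after the block is added, and the rows from l - q on have at
     least this degree in the end; so the first l - q degrees are the smallest. *)
  split => // i i' /andP[iq qi'].
  have := rows i; rewrite ifT; last by lia.
  case=> _ ->; apply: leq_trans (stage_le i st2) _.
  have := rows i'; case: ltnP => // i'u [_ ->].
  by rewrite /d2 /next_deg ifT //; lia.
move=> j; have [k' k'q ->] := Wc j; exists (hh' k') => //.
by rewrite CE map_f // mem_enum.
Qed.

End Sequence.
End Blocks.

(** * The ambient space as a presented coordinate ring *)

Lemma id_res (K : fieldType) (l : nat) (p : {mpoly K[l]}) :
  idfun p = idfun (res (1%:M : 'M[K]_l) p).
Proof. by rewrite /= res1. Qed.

Section Polynomials.
Context (K : fieldType) (l : nat).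
Local Notation S := {mpoly K[l]}.

Definition der_id_derivation :=
  @der_derivation K l l _ S idfun id (fun=> erefl) (fun=> erefl) idfun (@id_res K l).
Definition logder_idP :=
  @logderP K l l _ S idfun id (fun=> erefl) (fun=> erefl) idfun (@id_res K l) fullv.
Definition der_basis_idP :=
  @der_basisP K l l _ S idfun id (fun=> erefl) (fun=> erefl) idfun (@id_res K l) fullv.
Definition derivation_id_lf :=
  @derivation_lf K l l _ S idfun id (fun=> erefl) idfun (@id_res K l).
Definition vec_der_id := @vec_der K l S idfun id (fun=> erefl).

End Polynomials.

Lemma logder_der (K : fieldType) (l : nat) (A : {fset {vspace 'rV[K]_l}}) g :
  arrangement A -> logv (cols A) g -> logder idfun fullv A (der idfun id g).
Proof.
move=> arrA hg; apply/(logder_idP A (der_id_derivation g)).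
by rewrite vec_der_id; apply/rlog_cols.
Qed.

Lemma take_sort_map l m (d : 'I_l -> nat) (ml : (m <= l)%N) :
  (forall i i' : 'I_l, (i < m <= i')%N -> (d i <= d i')%N) ->
  take m (sort leq [seq d i | i : 'I_l])
    = sort leq [seq d (widen_ord ml i) | i : 'I_m].
Proof.
move=> dle; set X1 := [seq d (widen_ord ml i) | i : 'I_m].
pose X2 := [seq d i | i <- drop m (enum 'I_l)].
have tE : take m (enum 'I_l) = [seq widen_ord ml i | i <- enum 'I_m].
  apply: (inj_map val_inj); rewrite map_take val_enum_ord take_iota (minn_idPl ml).
  by rewrite -map_comp -[LHS]val_enum_ord; apply: eq_map.
have XE : [seq d i | i : 'I_l] = X1 ++ X2.
  transitivity (map d (take m (enum 'I_l) ++ drop m (enum 'I_l))).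
    by rewrite cat_take_drop.
  by rewrite map_cat tE -map_comp.
have -> : sort leq [seq d i | i : 'I_l] = sort leq X1 ++ sort leq X2.
  apply: (sorted_eq leq_trans anti_leq); first exact: sort_sorted leq_total _.
    rewrite (sorted_pairwise leq_trans) pairwise_cat -!(sorted_pairwise leq_trans).
    rewrite !(sort_sorted leq_total) !andbT; apply/allrelP => x y.
    rewrite !mem_sort => /mapP[i _ ->] /mapP[i' /(nthP i')[u]].
    rewrite size_drop size_enum_ord nth_drop => um <- ->; apply: dle.
    by rewrite /= (ltn_ord i) nth_enum_ord ?leq_addr //; lia.
  by rewrite perm_sort XE perm_cat // perm_sym perm_sort.
by rewrite take_size_cat // size_sort size_map size_enum_ord.
Qed.

(** * The coordinate ring of X and restricted derivations *)

Section CoordinateRing.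
Context (K : fieldType) (l m q : nat) (A : {fset {vspace 'rV[K]_l}}).
Context (X : {vspace 'rV[K]_l}) (M : 'M[K]_(m, l)) (U : 'M[K]_(l, m)).
Context (W : 'M[K]_(l, q)) (N : 'M[K]_(q, l)).
Hypothesis (UMWN : U *m M + W *m N = 1%:M) (MU : M *m U = 1%:M) (MW : M *m W = 0).
Hypothesis XM : forall v, (v \in X) = (v <= M)%MS.
Hypothesis WA : forall j, hp (col j W) \in A.
Hypothesis arrA : arrangement A.

(** P_X is the full vanishing ideal of X, because the columns of W are forms of members of A that
    cut out X. *)
Lemma P_memE p : P_mem A X p <-> res M p = 0.
Proof.
split => [/asboolP[s [sA ->]]|rp].
  rewrite rmorph_sum big_seq big1 // => y /sA[_]; rewrite lker_colf.
  rewrite (sub_hpE _ XM) rmorphM /= lform_colf res_lf => /eqP ->.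
  by rewrite lf0 mulr0.
have [h ->] := res_decomp UMWN p; rewrite -res_comp rp rmorph0 addr0.
apply/asboolP; exists [seq (h j, linfun (ev (col j W))) | j <- enum 'I_q].
split => [y /mapP[j _ ->] /=|].
  rewrite lker_colf colf_ev; split; first exact: WA.
  by rewrite (sub_hpE _ XM) mulmx_colE MW col0.
rewrite big_map big_enum; apply: eq_bigr => j _ /=.
by rewrite lform_colf colf_ev.
Qed.

Lemma coord_proj_eq p p' : coord_proj A X p = coord_proj A X p' <-> res M p = res M p'.
Proof.
have -> : res M p = res M p' <-> res M (p - p') = 0.
  by rewrite rmorphB /=; split => [->|/eqP]; rewrite ?subrr // subr_eq0 => /eqP.
rewrite -P_memE; split => [/eqP|h]; first by rewrite -Quotient.idealrBE.
by apply/eqP; rewrite -Quotient.idealrBE.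
Qed.

(** A function on X is extended to V along [U]; any other extension has the same class. *)
Definition coord_phi : {rmorphism {mpoly K[m]} -> coord_ring A X} :=
  (coord_proj A X \o res U)%FUN.

Definition coord_psi (r : coord_ring A X) : {mpoly K[m]} :=
  res M (repr (r : {ideal_quot (P_ideal A X)})).

Lemma coord_proj_surj (r : coord_ring A X) :
  coord_proj A X (repr (r : {ideal_quot (P_ideal A X)})) = r.
Proof. exact: reprK. Qed.

Lemma coord_phiK : cancel coord_phi coord_psi.
Proof.
move=> p; rewrite /coord_psi.
rewrite (proj1 (coord_proj_eq _ (res U p))) ?coord_proj_surj //.
by rewrite res_comp MU res1.
Qed.

Lemma coord_projE p : coord_proj A X p = coord_phi (res M p).
Proof. by apply/coord_proj_eq; rewrite [RHS]res_comp MU res1. Qed.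

Lemma coord_psiK : cancel coord_psi coord_phi.
Proof. by move=> r; rewrite /coord_psi -coord_projE coord_proj_surj. Qed.

Lemma restr_derivation th : logder idfun fullv A th ->
  derivation (coord_proj A X) (restr_der (A := A) (X := X) th).
Proof.
move=> lth; have [[thD thZ thM] _] := lth; have rE := @restr_derE K l A X th lth.
have surj r : exists p, r = coord_proj A X p.
  by eexists; apply: esym; apply: coord_proj_surj.
split=> [f g|c f|f g]; have [f' ->] := surj f; try have [g' ->] := surj g.
- by rewrite -rmorphD !rE thD rmorphD.
- by rewrite -rmorphM !rE thZ rmorphM.
- by rewrite -rmorphM !rE thM rmorphD !rmorphM.
Qed.

(** The j-th coordinate of X is the restriction of the form [col j U], whence the factor [U]. *)
Lemma vec_restr g : logv (cols A) g ->
  vec coord_phi coord_psi (restr_der (A := A) (X := X) (der idfun id g))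
    = map_mx (res M) g *m cst m U.
Proof.
move=> hg; have dg := der_id_derivation g.
have lg := logder_der arrA hg.
have psi_proj p : coord_psi (coord_proj A X p) = res M p.
  by rewrite coord_projE coord_phiK.
apply/rowP => j; rewrite mxE; have -> : coord_phi 'X_j = coord_proj A X (lf (col j U)).
  by rewrite /= resX.
rewrite restr_derE // psi_proj -[lf _]/(idfun (lf (col j U))).
rewrite (derivation_id_lf _ dg) vec_der_id.
rewrite mxE rmorph_sum mxE; apply: eq_bigr => i _ /=.
by rewrite rmorphM /= !mxE resC.
Qed.

End CoordinateRing.

Theorem theorem3p11 (K : fieldType) (hK : real_or_complex K) (l : nat)
    (A' B : {fset {vspace 'rV[K]_l}})
    (arrA' : arrangement A') (freeA' : D_free A')
    (arrB : arrangement B) (disjB : [disjoint B & A']%fset)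
    (n : nat) (p : nat -> {fset {vspace 'rV[K]_l}})
    (partB : ordered_partition n p B) (p_last : p n.+1 = fset0)
    (matA : forall k, (k < n)%N -> mat_step (add_blocks A' p k) (p k.+1)) :
  let A := (A' `|` B)%fset in
  forall k q : nat, (1 <= k <= n)%N -> (#|` p k.+1| <= q <= #|` p k|)%N ->
  exists2 C : {fset {vspace 'rV[K]_l}}, (C `<=` p k)%fset /\ #|` C| = q &
    let X := (\bigcap_(H <- C) H)%VS in
    [/\ DX_free A X,
        DX_exp A X = take (l - q) (D_exp A)
      & exists th : 'I_l -> {mpoly K[l]} -> {mpoly K[l]},
          D_basis A th /\
          DX_basis (fun i : 'I_(l - q) =>
            restr_der (A := A) (X := X) (th (widen_ord (leq_subr q l) i)))].
Proof.
move=> A k q /andP[k1 kn] hq.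
have [pne _ BE] := partB; pose Ak := add_blocks A' p.
have AkE j : (Ak j.+1 = Ak j `|` p j.+1)%fset.
  have iE : iota 1 j.+1 = iota 1 j ++ [:: j.+1] by rewrite -{1}(addn1 j) iotaD.
  by rewrite /Ak /add_blocks iE big_cat big_seq1 fsetUA.
have AE : Ak n = A by rewrite /Ak /add_blocks -BE.
have Ak0 : Ak 0%N = A' by rewrite /Ak /add_blocks big_nil fsetU0.
have arrAk j : (j <= n)%N -> arrangement (Ak j).
  elim: j => [|j IH] jn; first by rewrite Ak0.
  have [_ [arrp _] _ _ _] := matA _ jn; move=> H; rewrite AkE inE => /orP[|].
    by apply: IH; apply: ltnW.
  exact: arrp.
have p0 j : (j < n)%N -> p j.+1 != fset0 by move=> jn; apply: pne.
have arrA : arrangement A by rewrite -AE; apply: arrAk.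
(* Blocks are numbered from 1: from here on the block is [p k.+1] and the next one [p k.+2]. *)
case: k k1 kn hq => // k _ kn hq.
have l0 : (0 < l)%N.
  have /fset0Pn[H Hp] := p0 _ kn; have [_ [arrp _] _ _ _] := matA _ kn.
  by have := arrp _ Hp; lia.
have [G0 [d0 [r0 [E0 st0]]]] := stage_exists arrA' l0 freeA'.
rewrite -Ak0 in st0.
have [C [Cp Cq]] := block_restriction arrAk (fun j _ => AkE j) matA p0 p_last st0 kn hq.
rewrite AE => -[G [d [M [U [W [N [[UMWN MU MW] XM WC [bG hG dle] bZ]]]]]]].
exists C => // X.
have arrp : arrangement (p k.+1) by have [_ [? _] _ _ _] := matA _ kn.
have pA Y : Y \in p k.+1 -> Y \in A.
  move=> Yp; rewrite -AE; apply: (fsubsetP (chain_sub (n := n) (fun j _ => AkE j) (j := k.+1) (k := n) _)).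
    by rewrite kn leqnn.
  by rewrite AkE inE Yp orbT.
have WA j : hp (col j W) \in A.
  have [Y YC ->] := WC j; have Yp := fsubsetP Cp _ YC.
  by rewrite (cofP (arrp _ Yp)).2 pA.
have phiK := coord_phiK UMWN MU MW XM WA.
have psiK := coord_psiK UMWN MU MW XM WA.
have projE := coord_projE UMWN MU MW XM WA.
have logG i : logv (cols A) (row i G) by case: bG.
pose th i := der idfun id (row i G).
have dth i : derivation idfun (th i).
  exact: der_id_derivation.
pose w (i : 'I_(l - q)) := widen_ord (leq_subr q l) i.
have drth i : derivation (coord_proj A X) (restr_der (A := A) (X := X) (th (w i))).
  by apply: restr_derivation; apply: logder_der.
have DXb : DX_basis (fun i => restr_der (A := A) (X := X) (th (w i))).
  apply/(der_basisP phiK psiK projE) => //.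
  suff -> : \matrix_i vec (coord_phi A X U) (coord_psi M (X := X))
      (restr_der (X := X) (th (w i)))
    = map_mx (res M) (\matrix_i row (w i) G) *m cst (l - q) U by [].
  apply/row_matrixP => i; rewrite rowK (vec_restr UMWN MU MW XM WA arrA) //.
  by rewrite row_mul -map_row rowK.
have hZ : hrows (map_mx (res M) (\matrix_i row (w i) G) *m cst (l - q) U) (d \o w).
  move=> i j; rewrite mxE; apply: rpred_sum => u _.
  rewrite map_mx_entry [cst _ _ _ _]mxE mulrC mul_mpolyC; apply: rpredZ.
  by apply: res_homog; rewrite !mxE; apply: hG.
split.
- by exists (l - q)%N; exists (fun i => restr_der (A := A) (X := X) (th (w i))).
- rewrite /DX_exp (exponents_basis MU phiK psiK projE bZ hZ) (exp_basis arrA bG hG).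
  by rewrite (take_sort_map (leq_subr q l)).
exists th; split => //; apply/(der_basis_idP A dth).
have -> : \matrix_i vec idfun id (th i) = G.
  by apply/row_matrixP => i; rewrite rowK vec_der.
by apply: isbasis_ext bG => g; rewrite rlog_cols.
Qed.
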